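(* Let $\ell\ne p$ be a prime and let $e_i$ be the multiplicity of $\ell^i$ as an elementary divisor of the Laplacian matrix $L$ of the skew-lines graph $\Gamma$ on the $2$-dimensional subspaces of $V=\mathbb F_q^n$ ($n\ge4$, $q=p^t$). Put $f=[n]-1$, $g=\left[\begin{smallmatrix}n\\2\end{smallmatrix}\right]_q-[n]$, $$r=\frac{q^2[n-3][n]}{q+1},\qquad s=\frac{q[n-1]\left([n-1]-(q+2)\right)}{q+1},\qquad \mu=\frac{q^3[n-3]\left([n-1]-(q+2)\right)}{q+1}.$$ In each case below, $e_i=0$ for all $i$ not listed. (A) Suppose $\ell\nmid q+1$. Then $\ell$ divides at most one of $r$ and $s$; if it divides neither, then $\ell\nmid|K(\Gamma)|$. (i) Suppose $\ell\mid r$, $\ell\nmid s$. (a) If $\ell\mid[n]$ and $\ell\nmid[n-3]$, with $a=v_\ell([n])$: $e_a=f-1$, $e_0=g+1$. (b) If $\ell\mid[n]$ and $\ell\mid[n-3]$, with $a=v_\ell([n])$, $b=v_\ell([n-3])$: $e_{a+b}=f-1$, $e_b=1$, $e_0=g$. (c) If $\ell\nmid[n]$ and $\ell\mid[n-3]$, with $a=v_\ell([n-3])$: $e_a=f$, $e_0=g$. (ii) Suppose $\ell\mid s$, $\ell\nmid r$. (a) If $\ell\nmid[n-1]$, with $a=v_\ell(s)$: $e_a=g$, $e_0=f$. (b) If $\ell\mid[n-1]$, let $a=v_\ell([n-1])$ and $b=v_\ell(\mu)$, so that $v_\ell(s)=a+b$. If $b=0$: $e_a=g-1$, $e_0=f+1$.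 If $b>0$: $e_{a+b}=g-1$, $e_b=1$, $e_0=f$. (B) Suppose $\ell\mid q+1$ and $n$ is even. Let $a=v_\ell(r)$, $b=v_\ell(s)$. Then $a>0$ if and only if $b>0$. If $a=b=0$, then $\ell\nmid|K(\Gamma)|$. If $a,b>0$: $e_{a+b}=f-1$, $e_b=g-f+1$, $e_0=f$. (C) Suppose $\ell\mid q+1$, $n$ is odd and $\ell$ divides $|K(\Gamma)|$. Let $a=v_\ell(r)$, $b=v_\ell(s)$; exactly one of $a,b$ is nonzero. (a) Suppose $\ell\nmid\frac{n-1}{2}$. If $a>0$, $b=0$: $e_a=f$, $e_0=g$. If $a=0$, $b>0$: $e_b=g$, $e_0=f$. (b) Suppose $\ell\mid\frac{n-1}{2}$. Then $b>0$, $a=0$, and $e_b=g-1$, $e_0=f+1$.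
   Context: Let $p$ be a prime, $q=p^t$ with $t\ge1$, $n\ge4$, and $V$ an $n$-dimensional vector space over $\mathbb F_q$. Notation: $[m]=\frac{q^m-1}{q-1}$, and $\left[\begin{smallmatrix}m\\k\end{smallmatrix}\right]_q$ is the number of $k$-dimensional subspaces of $\mathbb F_q^m$; $v_\ell$ is the $\ell$-adic valuation. The skew-lines graph $\Gamma$ has as vertices the $2$-dimensional subspaces of $V$, two being adjacent when their intersection is $\{0\}$. If $A$ is its adjacency matrix and $k=q^4\left[\begin{smallmatrix}n-2\\2\end{smallmatrix}\right]_q$ its valency, $L=kI-A$. The integers $r$ and $s$ above are the nonzero eigenvalues of $L$ (with multiplicities $f$ and $g$). The critical group $K(\Gamma)$ is the torsion subgroup of the cokernel of $L$ over $\mathbb Z$. The multiplicity of $\ell^i$ as an elementary divisor of an integer matrix is the number of nonzero diagonal entries of its Smith normal form whose $\ell$-adic valuation is exactly $i$ (zero diagonal entries are not counted). *)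

(* Defs.v *)
From HB Require Import structures.
From mathcomp Require Import all_boot all_order all_algebra ring_quotient.
From mathcomp Require Import finmap.
From mathcomp Require Import boolp classical_sets cardinality.

Set Implicit Arguments.
Unset Strict Implicit.
Unset Printing Implicit Defensive.

Import GRing.Theory VectorInternalTheory.

Local Open Scope ring_scope.

Section VspaceFinite.
Variables (F : finFieldType) (V : vectType F).

HB.instance Definition _ := isCountable.Build {vspace V}
  (pcan_pickleK (can_pcan (@vs2mxK F V))).
HB.instance Definition _ := isFinite.Build {vspace V}
  (pcan_enumP (can_pcan (@vs2mxK F V))).

End VspaceFinite.

(* For 1 < q the division is exact. *)
Definition qint (q m : nat) : nat := ((q ^ m - 1) %/ (q - 1))%N.

Definition qbinom (F : finFieldType) (m k : nat) : nat :=
  #|[pred U : {vspace 'rV[F]_m} | \dim U == k]|.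

Section SkewLines.
Variables (F : finFieldType) (V : vectType F).

(* 2-dimensional subspaces of V, i.e. lines of the projective space of V. *)
Definition line : finType := {U : {vspace V} | \dim U == 2%N}.

Definition skew : rel line := fun U W => (val U :&: val W == 0)%VS.

Definition skew_adjacency : 'M[int]_#|line| :=
  \matrix_(i, j) (skew (enum_val i) (enum_val j))%:R.

Definition skew_valency : nat := (#|F| ^ 4 * qbinom F (\dim {:V} - 2) 2)%N.

Definition skew_laplacian : 'M[int]_#|line| :=
  skew_valency%:R%:M - skew_adjacency.

End SkewLines.

(* d is the diagonal of a Smith normal form of M. The entries are determined
   by M up to sign; zero entries, if any, come last since 0 only divides 0. *)
Definition smith_diagonal (N : nat) (M : 'M[int]_N) (d : 'rV[int]_N) : Prop :=
  (forall i j : 'I_N, (i <= j)%N -> (d ord0 i %| d ord0 j)%Z) /\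
  exists P Q : 'M[int]_N,
    [/\ P \in unitmx, Q \in unitmx & P *m M *m Q = diag_mx d].

Lemma smith_diagonal_exists (N : nat) (M : 'M[int]_N) :
  exists d, smith_diagonal M d.
Proof.
have [P uP [Q uQ [d sd ->]]] := int_Smith_normal_form M.
exists (\row_i d`_i); split.
  move=> i j le_ij; rewrite !mxE.
  have [ge_j|lt_j] := leqP (size d) j.
    by rewrite (nth_default 0 ge_j) dvdz0.
  apply: (sorted_leq_nth _ _ 0 sd) => //.
  - by move=> x y z; apply: dvdz_trans.
  - by move=> x; apply: dvdzz.
  - by rewrite inE (leq_ltn_trans le_ij).
exists (invmx P), (invmx Q); split; rewrite ?unitmx_inv //.
rewrite !mulmxA mulVmx // mul1mx -mulmxA mulmxV // mulmx1.
by apply/matrixP => i j; rewrite !mxE.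
Qed.

(* Multiplicity of l ^ i as an elementary divisor of a matrix with Smith
   diagonal d. The test d ord0 j != 0 matters because logn l 0 = 0. *)
Definition eldiv_mult (N : nat) (d : 'rV[int]_N) (l i : nat) : nat :=
  #|[pred j : 'I_N | (d ord0 j != 0) && (logn l `|d ord0 j|%N == i)]|.

(* e i = m for each pair (i, m) listed in s, and e vanishes elsewhere. *)
Definition exactly (e : nat -> nat) (s : seq (nat * nat)) : Prop :=
  (forall i m, (i, m) \in s -> e i = m) /\
  (forall i, i \notin unzip1 s -> e i = 0%N).

Section Cokernel.
Variables (m n : nat) (M : 'M[int]_(m, n)).

Definition mximage : {pred 'cV[int]_m} := fun v => `[< exists w, v = M *m w >].

Lemma mximage_zmod_closed : zmod_closed mximage.
Proof.
split=> [|u v /asboolP[x ->] /asboolP[y ->]]; apply/asboolP.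
  by exists 0; rewrite mulmx0.
by exists (x - y); rewrite mulmxBr.
Qed.
HB.instance Definition _ :=
  GRing.isZmodClosed.Build 'cV[int]_m mximage mximage_zmod_closed.

Definition coker : zmodType :=
  Quotient.quot (mximage : zmodClosed 'cV[int]_m).

Definition coker_torsion : set coker :=
  [set x | exists2 k : nat, (0 < k)%N & x *+ k = 0]%classic.

End Cokernel.
Arguments coker_torsion {m n} M.

(* The torsion subgroup of a finitely generated abelian group is finite, so
   fset_set, which sends infinite sets to the empty one, is not degenerate. *)
Definition critical_order (F : finFieldType) (V : vectType F) : nat :=
  #|` fset_set (coker_torsion (skew_laplacian V))|%fset.

(* Main.v *)
Require Import Defs.
From mathcomp Require Import all_boot all_order all_algebra finfield.
From mathcomp Require Import generic_quotient ring_quotient finmap.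
From mathcomp Require Import boolp classical_sets cardinality.
From mathcomp Require Import zify ring.

(* Let N be the point-line incidence matrix of V, a = [n-1] the number of lines
   on a point, D = q + 1 and P = [n]. Then N N^T = (a - 1) I + J and
   L = s I + N^T N - J, so L maps a row N_i to r N_i - u 1 with r = s + a - 1
   and u = a - D, and it kills the all-one vector 1. Modulo a prime l <> p, all
   rows but one of N are independent together with 1: a relation is constant
   on the points of every plane, as one sees by summing it over the lines of the
   plane through a point. Hence the differences N_i - N_1, the row N_1 and 1
   extend to a basis of the l-local lattice, in which L is block triangular with
   diagonal entries r, s and the column (r, -u). Its elementary divisors over
   Z_(l) can then be read off in three cases: s is an l-unit; r is an l-unit; or
   l divides q + 1 and both r and s. The third case needs that the off-diagonal
   block has full row rank mod l, the second one that the line sums of the additional basis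
   vectors do not all vanish mod l; both follow from N N^T = (a - 1) I + J. *)

Set Implicit Arguments.
Unset Strict Implicit.
Unset Printing Implicit Defensive.

Import GRing.Theory.

(** * Equivalence of integer matrices over Z_(l) *)

(** The eigenvalues differ by r - s = a - 1, which l may divide, so the lattice need not split into
    eigenlattices and only a triangular form is sought. The rows of N add up to D 1; omitting N_0
    removes this relation without dividing by D. The omitted point and the base point are distinct
    on purpose: for the other points, N_i - N_0 and N_j - N_1 have inner product a - 1 if i = j and
    0 otherwise, so the two families pair by a scalar matrix. The blocks z and y of the last column,
    which sit in the rows with entries r and -u, are tied by one identity r y + u z = lam x, where x
    lists the line sums of the additional basis vectors and lam = u D - r is -mu for the graph. This
    identity is the source of the isolated exponent v(mu) when r is a unit. The isolated exponent
    v([n-3]), for s a unit and l prime to q + 1, is the valuation of gcd(r, u). *)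

Section LocalEquivalence.
Variable l : nat.
Hypothesis l_prime : prime l.

Local Open Scope ring_scope.

Definition modl m n (A : 'M[int]_(m, n)) : 'M['F_l]_(m, n) := map_mx intr A.

Definition lunitmx n (S : 'M[int]_n) := modl S \in unitmx.

(* A matrix is invertible over Z_(l) iff it is so mod l; up to factors prime to l
   the transformation matrices can be taken integral. *)
Definition lequiv n (A B : 'M[int]_n) :=
  exists S S', [/\ lunitmx S, lunitmx S' & A *m S = S' *m B].

Lemma intr_Fp_eq0 (x : int) : ((x%:~R : 'F_l) == 0) = (l %| x)%Z.
Proof.
have natE m : ((m%:R : 'F_l) == 0) = (l %| m)%N.
  by rewrite (dvdn_pcharf (pchar_Fp l_prime)).
by case: x => m; rewrite ?NegzE ?rmorphN ?oppr_eq0 natE.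
Qed.

Lemma modlM m n k (A : 'M[int]_(m, n)) (B : 'M_(n, k)) :
  modl (A *m B) = modl A *m modl B.
Proof. exact: map_mxM. Qed.

Lemma modlB m n (A B : 'M[int]_(m, n)) : modl (A - B) = modl A - modl B.
Proof. exact: map_mxB. Qed.

Lemma modlZ m n x (A : 'M[int]_(m, n)) : modl (x *: A) = x%:~R *: modl A.
Proof. exact: map_mxZ. Qed.

Lemma lunitmxM n (S T : 'M[int]_n) : lunitmx (S *m T) = lunitmx S && lunitmx T.
Proof. by rewrite /lunitmx modlM unitmx_mul. Qed.

Lemma lunitmxE n (S : 'M[int]_n) : lunitmx S = ~~ (l %| \det S)%Z.
Proof. by rewrite /lunitmx unitmxE det_map_mx unitfE intr_Fp_eq0. Qed.

Lemma lunitmx_unit n (S : 'M[int]_n) : S \in unitmx -> lunitmx S.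
Proof. by move=> uS; rewrite /lunitmx unitmxE det_map_mx rmorph_unit. Qed.

Lemma lunitmx1 n : lunitmx (1%:M : 'M_n).
Proof. by apply: lunitmx_unit; rewrite unitmx1. Qed.

Lemma lunitmx_tr n (S : 'M[int]_n) : lunitmx S^T = lunitmx S.
Proof. by rewrite !lunitmxE det_tr. Qed.

Lemma lunitmx_scalar n (c : int) : ~~ (l %| c)%Z -> lunitmx (c%:M : 'M_n).
Proof.
rewrite -intr_Fp_eq0 => c_neq0.
by rewrite /lunitmx /modl map_scalar_mx unitmxE det_scalar unitrX // unitfE.
Qed.

Lemma lunitmx_ublock m n (A : 'M[int]_m) (B : 'M_(m, n)) (C : 'M_n) :
  lunitmx (block_mx A B 0 C) = lunitmx A && lunitmx C.
Proof. by rewrite /lunitmx /modl map_block_mx map_mx0 !unitmxE det_ublock unitrM. Qed.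

Lemma lunitmx_lblock m n (A : 'M[int]_m) (B : 'M_(n, m)) (C : 'M_n) :
  lunitmx (block_mx A 0 B C) = lunitmx A && lunitmx C.
Proof. by rewrite /lunitmx /modl map_block_mx map_mx0 !unitmxE det_lblock unitrM. Qed.

Lemma lequiv_mulr n (A S : 'M[int]_n) : lunitmx S -> lequiv A (A *m S).
Proof. by exists S, 1%:M; rewrite lunitmx1 mul1mx. Qed.

Lemma lequiv_mull n (S A : 'M[int]_n) : lunitmx S -> lequiv (S *m A) A.
Proof. by exists 1%:M, S; rewrite lunitmx1 mulmx1. Qed.

Lemma lequiv_refl n (A : 'M[int]_n) : lequiv A A.
Proof. by exists 1%:M, 1%:M; rewrite lunitmx1 mulmx1 mul1mx. Qed.

Lemma lequiv_trans n (B A C : 'M[int]_n) :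
  lequiv A B -> lequiv B C -> lequiv A C.
Proof.
move=> [S [S' [uS uS' eAB]]] [T [T' [uT uT' eBC]]].
exists (S *m T), (S' *m T'); rewrite !lunitmxM uS uS' uT uT'; split=> //.
by rewrite mulmxA eAB -mulmxA eBC mulmxA.
Qed.

(* The adjugates invert S and S' up to factors prime to l. *)
Lemma lequiv_sym n (A B : 'M[int]_n) : lequiv A B -> lequiv B A.
Proof.
move=> [S [S' [uS uS' eAB]]].
exists (\det S' *: \adj S), (\det S *: \adj S'); split.
- have: lunitmx (S *m (\det S' *: \adj S)).
    rewrite -scalemxAr mul_mx_adj scale_scalar_mx lunitmx_scalar //.
    by rewrite -intr_Fp_eq0 rmorphM mulf_eq0 negb_or !intr_Fp_eq0 -!lunitmxE uS uS'.
  by rewrite lunitmxM => /andP[].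
- have: lunitmx (S' *m (\det S *: \adj S')).
    rewrite -scalemxAr mul_mx_adj scale_scalar_mx lunitmx_scalar //.
    by rewrite -intr_Fp_eq0 rmorphM mulf_eq0 negb_or !intr_Fp_eq0 -!lunitmxE uS uS'.
  by rewrite lunitmxM => /andP[].
rewrite -scalemxAr -scalemxAl.
have -> : \det S' *: (B *m \adj S) = \adj S' *m (A *m S) *m \adj S.
  by rewrite eAB mulmxA mul_adj_mx mul_scalar_mx scalemxAl.
by rewrite -!mulmxA mul_mx_adj mul_mx_scalar -!scalemxAr -?scalemxAl.
Qed.

Lemma lequiv_block m n (A A' : 'M[int]_m) (B B' : 'M_n) :
  lequiv A A' -> lequiv B B' -> lequiv (block_mx A 0 0 B) (block_mx A' 0 0 B').
Proof.
move=> [S [S' [uS uS' eA]]] [T [T' [uT uT' eB]]].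
exists (block_mx S 0 0 T), (block_mx S' 0 0 T'); rewrite !lunitmx_ublock uS uS' uT uT'.
by rewrite !mulmx_block !(mulmx0, mul0mx, addr0, add0r) eA eB.
Qed.

(** The diagonal projectors on X and Y give [D X *m S *m D Y = 0], and Sylvester's rank inequality
    then bounds the sum of their ranks by n. This is the determinant form of the easy half of the
    Frobenius-Koenig theorem. *)
Lemma unitmx_zero_block (F : fieldType) n (S : 'M[F]_n) (X Y : pred 'I_n) :
  S \in unitmx -> (forall i j, X i -> Y j -> S i j = 0) -> (#|X| + #|Y| <= n)%N.
Proof.
move=> uS S0.
pose D (Z : pred 'I_n) : 'M[F]_n := diag_mx (\row_i (Z i)%:R).
have rkD Z : (#|Z| <= \rank (D Z))%N.
  pose g (i : 'I_#|Z|) := enum_val i.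
  have <- : \rank (rowsub g (D Z)) = #|Z|.
    apply/eqP/row_freeP; exists (rowsub g 1%:M)^T; apply/matrixP => i j.
    rewrite !mxE (bigD1 (g i)) //= !mxE eqxx mulr1n big1 ?addr0 => [|k kNi].
      by rewrite [Z (g i)](enum_valP i) mul1r eq_sym (inj_eq enum_val_inj).
    by rewrite !mxE eq_sym (negPf kNi) mulr0n mul0r.
  by rewrite rowsubE mxrankM_maxr.
have XSY0 : D X *m S *m D Y = 0.
  apply/matrixP => i j; rewrite mul_mx_diag mul_diag_mx !mxE.
  have [Xi|] := boolP (X i); have [Yj|] := boolP (Y j); rewrite ?(mul0r, mulr0) //.
  by rewrite S0 // mulr0 mul0r.
have := mxrank_mul_min (D X *m S) (D Y).
rewrite XSY0 mxrank0 mxrankMfree ?row_free_unit // leqn0 subn_eq0.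
by apply: leq_trans; rewrite leq_add.
Qed.

(* An entry S j k with l^i dividing d' k but not d j is divisible by l, so S has a
   zero block mod l; S' has the opposite one. *)
Lemma lequiv_diag_card n (d d' : 'rV[int]_n) i :
  lequiv (diag_mx d) (diag_mx d') ->
  #|[pred j | ((l ^ i)%N %| d ord0 j)%Z]| = #|[pred j | ((l ^ i)%N %| d' ord0 j)%Z]|.
Proof.
move=> [S [S' [uS uS' /matrixP eq_d]]].
have {}eq_d j k : d ord0 j * S j k = S' j k * d' ord0 k.
  by have := eq_d j k; rewrite mul_diag_mx mul_mx_diag !mxE.
have dvd_cancel (x y : int) : ((l ^ i)%N %| x * y)%Z -> ~~ ((l ^ i)%N %| x)%Z -> (y%:~R : 'F_l) = 0.
  move=> xy Nx; apply/eqP; rewrite intr_Fp_eq0; apply: contraR Nx => Ny.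
  by rewrite -(@Gauss_dvdzl _ _ y) // coprimezE /= coprimeXl // prime_coprime.
have le1 : (#|[predC [pred j | ((l ^ i)%N %| d ord0 j)%Z]]| +
            #|[pred j | ((l ^ i)%N %| d' ord0 j)%Z]| <= n)%N.
  apply: (unitmx_zero_block uS) => j k /= Nj k1.
  by rewrite mxE; apply: dvd_cancel Nj; rewrite eq_d dvdz_mull.
have le2 : (#|[pred j | ((l ^ i)%N %| d ord0 j)%Z]| +
            #|[predC [pred j | ((l ^ i)%N %| d' ord0 j)%Z]]| <= n)%N.
  apply: (unitmx_zero_block uS') => j k /= j1 Nk.
  by rewrite mxE; apply: dvd_cancel Nk; rewrite mulrC -eq_d dvdz_mulr.
have := cardC [pred j : 'I_n | ((l ^ i)%N %| d ord0 j)%Z].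
have := cardC [pred j : 'I_n | ((l ^ i)%N %| d' ord0 j)%Z].
rewrite card_ord => e1 e2; apply/eqP; rewrite eqn_leq.
rewrite -(leq_add2r #|[predC [pred j | ((l ^ i)%N %| d' ord0 j)%Z]]|) e1 le2 /=.
rewrite -(leq_add2l #|[predC [pred j | ((l ^ i)%N %| d ord0 j)%Z]]|).
by rewrite (addnC _ #|[pred j | ((l ^ i)%N %| d ord0 j)%Z]|) e2.
Qed.

(** Zero entries are divisible by every power of l, so they cancel between the two counts; counting
    by divisibility avoids the convention [logn l 0 = 0]. *)
Lemma eldiv_multE n (d : 'rV[int]_n) i :
  (eldiv_mult d l i + #|[pred j | ((l ^ i.+1)%N %| d ord0 j)%Z]|)%N =
  #|[pred j | ((l ^ i)%N %| d ord0 j)%Z]|.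
Proof.
rewrite -(cardID [pred j | ((l ^ i.+1)%N %| d ord0 j)%Z] [pred j | ((l ^ i)%N %| d ord0 j)%Z]).
rewrite addnC; congr (_ + _)%N; apply: eq_card => j; rewrite !inE.
  rewrite andb_idl // => /(dvdz_trans _)-> //.
  by rewrite dvdzE /= expnS dvdn_mull.
rewrite !dvdzE !absz_nat.
have [->|d0] := eqVneq (d ord0 j) 0; first by rewrite !absz0 !dvdn0.
by rewrite !pfactor_dvdn ?absz_gt0 // -ltnNge ltnS eqn_leq.
Qed.

Lemma lequiv_eldiv_mult n (d d' : 'rV[int]_n) :
  lequiv (diag_mx d) (diag_mx d') -> eldiv_mult d l =1 eldiv_mult d' l.
Proof.
move=> dd' i; apply/(@addIn #|[pred j | ((l ^ i.+1)%N %| d ord0 j)%Z]|).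
by rewrite eldiv_multE (lequiv_diag_card _ dd') (lequiv_diag_card _ dd') eldiv_multE.
Qed.

Lemma smith_diagonal_eldiv_mult n (M : 'M[int]_n) (d d' : 'rV[int]_n) :
  smith_diagonal M d -> lequiv M (diag_mx d') -> eldiv_mult d l =1 eldiv_mult d' l.
Proof.
move=> [_ [P [Q [uP uQ eq_d]]]] Md'; apply: lequiv_eldiv_mult; apply: lequiv_trans Md'.
apply: (lequiv_trans (B := M *m Q)); last exact/lequiv_sym/lequiv_mulr/lunitmx_unit.
by rewrite -eq_d -mulmxA; apply/lequiv_mull/lunitmx_unit.
Qed.

Lemma eldiv_mult_row_mx m n (d1 : 'rV[int]_m) (d2 : 'rV_n) i :
  eldiv_mult (row_mx d1 d2) l i = (eldiv_mult d1 l i + eldiv_mult d2 l i)%N.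
Proof.
rewrite /eldiv_mult -!sum1_card big_mkcond big_split_ord /=.
by congr (_ + _)%N; rewrite [RHS]big_mkcond; apply: eq_bigr => j _;
  rewrite !inE (row_mxEl, row_mxEr).
Qed.

Lemma eldiv_mult_const n (c : int) i :
  eldiv_mult (const_mx c : 'rV_n) l i = if (c != 0) && (logn l `|c|%N == i) then n else 0.
Proof.
rewrite /eldiv_mult; case: ifP => c_i; last first.
  by apply: eq_card0 => j; rewrite !inE !mxE c_i.
by rewrite -[RHS]card_ord; apply: eq_card => j; rewrite !inE !mxE c_i.
Qed.

(** A complement over F_l, lifted entrywise to representatives, is enough, because invertibility
    over Z_(l) is tested mod l only. *)
Lemma row_free_complete m k n (Y : 'M[int]_(m, n)) :
  n = (m + k)%N -> row_free (modl Y) ->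
  exists Z : 'M[int]_(k, n), row_full (modl (col_mx Y Z)).
Proof.
move=> n_mk rfY.
have rkC : \rank (modl Y)^C%MS = k by rewrite mxrank_compl (eqP rfY) n_mk addKn.
pose W : 'M['F_l]_(k, n) := castmx (rkC, erefl) (row_base (modl Y)^C%MS).
exists (map_mx (fun x : 'F_l => (x : nat)%:Z) W).
rewrite /modl map_col_mx -map_mx_comp (_ : map_mx _ W = W); last first.
  by apply/matrixP => i j; rewrite !mxE /=; apply: natr_Zp.
rewrite -/(modl Y) -sub1mx (submx_trans (submx_full 1%:M (addsmx_compl_full (modl Y)))) //.
by rewrite -addsmxE addsmxS // /W eqmx_cast eq_row_base.
Qed.

End LocalEquivalence.

(** * Block normal forms *)

Definition blockE := (mulmx_block, mul_col_row, mul_row_block, mul_block_col, mul_row_col,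
  mul_mx_row, mul_col_mx, mulmx0, mul0mx, mulmx1, mul1mx, add_block_mx, add_row_mx, add_col_mx,
  add0r, addr0, mul_scalar_mx, mul_mx_scalar, scaler0, scale1r, row_mx0, col_mx0,
  scale_block_mx, scale_row_mx, scale_col_mx, scale_scalar_mx, mulr1, oppr0).

Section BlockNormalForms.
Variable l : nat.
Hypothesis l_prime : prime l.

Local Open Scope ring_scope.

Lemma lunitmx_rinv n (S T : 'M[int]_n) : S *m T = 1%:M -> lunitmx l S.
Proof. by case/mulmx1_unit => uS _; apply: lunitmx_unit. Qed.

Lemma lequiv_scale n c (A B : 'M[int]_n) : lequiv l A B -> lequiv l (c *: A) (c *: B).
Proof.
by move=> [S [S' [uS uS' eAB]]]; exists S, S'; rewrite -scalemxAl eAB scalemxAr.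
Qed.

(** As Y X = 1, X Y is a projector, and the matrix is a product of four unitriangular block
    matrices. *)
Lemma lunitmx_hyperbolic h k (s : int) (Y : 'M[int]_(h, k)) (X : 'M_(k, h)) :
  Y *m X = 1%:M ->
  lunitmx l (block_mx 0 Y (- X) (1%:M - X *m Y + s *: (X *m Y))).
Proof.
move=> YX1; have XYX : X *m Y *m X = X by rewrite -mulmxA YX1 mulmx1.
have -> : block_mx 0 Y (- X) (1%:M - X *m Y + s *: (X *m Y)) =
    block_mx 1%:M 0 (s *: X) 1%:M *m block_mx 1%:M Y 0 1%:M
    *m block_mx 1%:M 0 (- X) 1%:M *m block_mx 1%:M Y 0 1%:M.
  rewrite !blockE; congr block_mx.
  - by rewrite mulmxN YX1 subrr.
  - by rewrite mulmxN YX1 subrr mul0mx add0r.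
  - by rewrite mulmxN mulmxDl mul1mx -!scalemxAl XYX opprD addNKr.
  rewrite mulmxN [(_ + 1%:M) *m X]mulmxDl mul1mx -!scalemxAl XYX opprD addNKr.
  by rewrite mulNmx [s *: _ + _]addrC addrA [- _ + 1%:M]addrC.
by rewrite !(lunitmxM, lunitmx_ublock, lunitmx_lblock) ?lunitmx1.
Qed.

(** M is the identity on the projector X Y, so M + (s - 1) X Y has s there in place of 1. The pairs
    (r 1; 0 s) formed in this way reduce to the diagonal (r s, 1). *)
Lemma lequiv_hyperbolic h k (r s : int) (Y : 'M[int]_(h, k)) (X : 'M_(k, h)) M :
  Y *m X = 1%:M -> Y *m M = Y -> M *m X = X ->
  lequiv l (block_mx r%:M Y 0 (M + (s - 1) *: (X *m Y))) (block_mx (r * s)%:M 0 0 M).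
Proof.
move=> YX1 YM MX.
exists (block_mx 1%:M 0 (- (r *: X)) 1%:M); eexists; split; last first.
- have -> : block_mx r%:M Y 0 (M + (s - 1) *: (X *m Y)) *m
      block_mx 1%:M 0 (- (r *: X)) 1%:M =
    block_mx 0 Y (- X) (1%:M - X *m Y + s *: (X *m Y)) *m block_mx (r * s)%:M 0 0 M.
    rewrite !blockE; congr block_mx.
    + by rewrite mulmxN -scalemxAr YX1 scale_scalar_mx mulr1 subrr.
    + by rewrite YM.
    + rewrite mulmxN -scalemxAr mulmxDl MX -scalemxAl -mulmxA YX1 mulmx1.
      by rewrite scalerBl scale1r addrC subrK scalerA scalerN.
    by rewrite mulmxDl mulmxBl mul1mx -scalemxAl -mulmxA YM scalerBl scale1r addrA addrAC.
  by [].
- exact: lunitmx_hyperbolic.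
by rewrite lunitmx_lblock ?lunitmx1.
Qed.

(* The matrix of L in the basis formed by the h differences N_i - N_1, the row N_1,
   the all-one vector and g further vectors. *)
Definition eigenblock h g (r u s : int) (Y : 'M[int]_(h, g)) (z y : 'rV_g) :
    'M[int]_(h + (1 + (1 + g))) :=
  block_mx r%:M (row_mx 0 (row_mx 0 Y)) 0
    (block_mx r%:M (row_mx 0 z) (col_mx (- u)%:M 0) (block_mx 0 y 0 s%:M)).

(** Multiples of the rows with the unit s clear the last column; Bezout cofactors then reduce the
    column (r, -u) to its gcd. *)
Lemma lequiv_eigenblock_unit_s h g (r u s : int) (Y : 'M[int]_(h, g)) z y :
  ~~ (l %| s)%Z ->
  lequiv l (eigenblock r u s Y z y)
    (diag_mx (row_mx (const_mx r)
      (row_mx (const_mx (gcdz r u)) (row_mx (const_mx 0) (const_mx 1))))).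
Proof.
move=> s_unit; rewrite !diag_mx_row !diag_const_mx.
pose C : 'M[int]_(h + (1 + (1 + g))) := block_mx r%:M 0 0
  (block_mx r%:M 0 (col_mx (- u)%:M 0) (block_mx 0 0 0 1%:M)).
apply: (lequiv_trans (B := C)).
  have -> : eigenblock r u s Y z y =
      block_mx 1%:M (row_mx 0 (row_mx 0 Y)) 0
        (block_mx 1%:M (row_mx 0 z) 0 (block_mx 1%:M y 0 s%:M)) *m C.
    by rewrite !blockE.
  apply: lequiv_mull => //.
  by rewrite !lunitmx_ublock ?lunitmx1 ?lunitmx_scalar.
apply: lequiv_block => //; first exact: lequiv_refl.
(* The Bezout identity must be divided by the gcd; for r = u = 0 the two sides already coincide. *)
have [g0|g_neq0] := eqVneq (gcdz r u) 0.
  have /eqP := g0; rewrite gcdz_eq0 => /andP[/eqP-> /eqP->].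
  by rewrite gcd0z absz0 oppr0 !raddf0 col_mx0; apply: lequiv_refl.
have /dvdzP[r' r'E] := dvdz_gcdl r u.
have /dvdzP[u' u'E] := dvdz_gcdr r u.
have [al [be bez]] := Bezoutz r u.
have {}bez : al * r' + be * u' = 1.
  by apply: (mulIf g_neq0); rewrite mul1r mulrDl -!mulrA -r'E -u'E.
pose S' : 'M[int]_(1 + (1 + g)) := block_mx r'%:M (row_mx be%:M 0) (col_mx (- u')%:M 0)
  (block_mx al%:M 0 0 1%:M).
have -> : block_mx r%:M 0 (col_mx (- u)%:M 0) (block_mx 0 0 0 1%:M) =
    S' *m block_mx (gcdz r u)%:M 0 0 (block_mx 0%:M 0 0 1%:M).
  by rewrite raddf0 !blockE mulNr -r'E -u'E.
apply: lequiv_mull; apply: (lunitmx_rinv (T := block_mx al%:M (row_mx (- be)%:M 0)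
  (col_mx u'%:M 0) (block_mx r'%:M 0 0 1%:M))).
rewrite !blockE !scalar_mx_block; congr block_mx; rewrite -?raddfD /=.
- by rewrite (mulrC r') bez.
- by rewrite mulrN mulrC addNr raddf0 row_mx0.
- by rewrite mulNr mulrC addNr raddf0 col_mx0.
by rewrite (_ : - u' * - be + al * r' = 1) // -bez; ring.
Qed.

(** Row 3 times r plus row 2 times u turns (-u, y) into (0, r y + u z); the unit r then clears Y and
    z by column operations. *)
Lemma lequiv_eigenblock_unit_r h g (r u s lam : int) (Y : 'M[int]_(h, g)) z y x :
  ~~ (l %| r)%Z -> r *: y + u *: z = lam *: x ->
  lequiv l (eigenblock r u s Y z y)
    (block_mx 1%:M 0 0 (block_mx 1%:M 0 0 (block_mx 0 (lam *: x) 0 s%:M))).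
Proof.
move=> r_unit lam_x.
pose B : 'M[int]_(h + (1 + (1 + g))) := block_mx r%:M (row_mx 0 (row_mx 0 Y)) 0
  (block_mx r%:M (row_mx 0 z) 0 (block_mx 0 (lam *: x) 0 s%:M)).
apply: (lequiv_trans (B := B)).
  have -> : B = block_mx 1%:M 0 0 (block_mx 1%:M 0 (col_mx u%:M 0) (block_mx r%:M 0 0 1%:M))
      *m eigenblock r u s Y z y.
    rewrite !blockE (addrC (u *: z)) lam_x.
    by rewrite mulrN mulrC -raddfD /= subrr raddf0 col_mx0.
  apply: lequiv_sym => //; apply: lequiv_mull => //.
  by rewrite !(lunitmx_ublock, lunitmx_lblock) ?lunitmx1 ?lunitmx_scalar.
have -> : B = block_mx 1%:M 0 0 (block_mx 1%:M 0 0 (block_mx 0 (lam *: x) 0 s%:M)) *m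
    block_mx r%:M (row_mx 0 (row_mx 0 Y)) 0 (block_mx r%:M (row_mx 0 z) 0 1%:M).
  by rewrite !blockE.
apply: lequiv_sym => //; apply: lequiv_mulr => //.
by rewrite !lunitmx_ublock ?lunitmx1 ?lunitmx_scalar.
Qed.

(** Here s divides lam over Z_(l), so the row lam x is a combination of the rows of s I and
    disappears. *)
Lemma lequiv_eigenblock_unit_r_absorb h g (r u s lam e s' : int) (Y : 'M[int]_(h, g)) z y x :
  ~~ (l %| r)%Z -> r *: y + u *: z = lam *: x ->
  ~~ (l %| e)%Z -> e * lam = s * s' ->
  lequiv l (eigenblock r u s Y z y)
    (diag_mx (row_mx (const_mx 1) (row_mx (const_mx 1) (row_mx (const_mx 0) (const_mx s))))).
Proof.
move=> r_unit lam_x e_unit e_lam; apply: (lequiv_trans).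
  exact: lequiv_eigenblock_unit_r lam_x.
rewrite !diag_mx_row !diag_const_mx.
do 2![apply: lequiv_block; first exact: lequiv_refl].
have -> : block_mx 0%:M 0 0 s%:M = block_mx e%:M (- s' *: x) 0 1%:M *m
    block_mx 0 (lam *: x) 0 s%:M :> 'M_(1 + g).
  by rewrite raddf0 !blockE !scalerA e_lam -scalerDl mulrN subrr scale0r.
apply: lequiv_sym => //; apply: lequiv_mull => //.
by rewrite lunitmx_ublock lunitmx1 lunitmx_scalar.
Qed.

(** Here lam divides s over Z_(l). Completing x to a basis turns lam x into (lam, 0), and this row
    replaces one entry s by lam. *)
Lemma lequiv_eigenblock_unit_r_primitive h k (r u s lam e s' : int)
    (Y : 'M[int]_(h, 1 + k)) z y (x : 'rV_(1 + k)) :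
  ~~ (l %| r)%Z -> r *: y + u *: z = lam *: x -> row_free (modl l x) ->
  ~~ (l %| e)%Z -> e * s = lam * s' ->
  lequiv l (eigenblock r u s Y z y)
    (diag_mx (row_mx (const_mx 1) (row_mx (const_mx 1)
      (row_mx (const_mx 0) (row_mx (const_mx lam) (const_mx s)))))).
Proof.
move=> r_unit lam_x rf_x e_unit e_s; apply: (lequiv_trans).
  exact: lequiv_eigenblock_unit_r lam_x.
have [Z] := row_free_complete erefl rf_x.
rewrite row_full_unit -/(lunitmx l _) => unitR.
rewrite !diag_mx_row !diag_const_mx.
do 2![apply: lequiv_block; first exact: lequiv_refl].
pose v : 'M[int]_(1, 1 + k) := row_mx 1%:M 0.
pose A : 'M[int]_(1 + (1 + k)) := block_mx 0 (lam *: v) 0 (lam * s')%:M.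
apply: (lequiv_trans (B := A)).
  apply: (lequiv_trans (B := block_mx 0 (lam *: x) 0 (lam * s')%:M)).
    have -> : block_mx 0 (lam *: x) 0 (lam * s')%:M =
      block_mx 1%:M 0 0 e%:M *m block_mx 0 (lam *: x) 0 s%:M :> 'M_(1 + (1 + k)).
      by rewrite !blockE e_s.
    apply: lequiv_sym => //; apply: lequiv_mull => //.
    by rewrite lunitmx_ublock lunitmx1 lunitmx_scalar.
  apply: lequiv_sym => //.
  exists (block_mx 1%:M 0 0 (col_mx x Z)), (block_mx 1%:M 0 0 (col_mx x Z)).
  rewrite !lunitmx_ublock lunitmx1 unitR; split=> //.
  by rewrite /A /v !blockE.
(* With r = 0 the hyperbolic pair is (0 1; 0 s'), which reduces to (0, 1); scaling by lam gives the
   block at hand. *)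
have := @lequiv_hyperbolic 1 (1 + k) 0 s' v (col_mx 1%:M 0) (block_mx 1%:M 0 0 s'%:M).
rewrite /v !blockE mul0r => /(_ erefl erefl erefl) /(lequiv_scale lam).
rewrite !blockE -raddfD /= addrC subrK ?scale_scalar_mx mulr0 raddf0 => Av.
apply: (lequiv_trans (B := block_mx 0 0 0 (block_mx lam%:M 0 0 (lam * s')%:M))).
  suff -> : A = block_mx 0 (row_mx lam%:M 0) 0 (block_mx (lam * s')%:M 0 0 (lam * s')%:M). by [].
  by rewrite /A /v !blockE -scalar_mx_block.
have -> : block_mx 0 0 0 (block_mx lam%:M 0 0 (lam * s')%:M) =
   block_mx 1%:M 0 0 (block_mx 1%:M 0 0 e%:M) *m
   block_mx 0 0 0 (block_mx lam%:M 0 0 s%:M) :> 'M_(1 + (1 + k)).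
  by rewrite !blockE e_s.
by apply: lequiv_mull; rewrite !lunitmx_ublock !lunitmx1 lunitmx_scalar.
Qed.

(** Row 2 times a u, plus row 3 times a r, plus u x times the rows of s I is zero, because a lam + u
    s = 0. The unit u then clears y from row 3, and completing Y to a basis leaves h hyperbolic
    pairs (r 1; 0 s) and k entries s. *)
Lemma lequiv_eigenblock_ramified h k (r u s lam a : int) (Y : 'M[int]_(h, h + k)) z y x :
  ~~ (l %| u)%Z -> ~~ (l %| a)%Z -> r *: y + u *: z = lam *: x ->
  a * lam = - u * s -> row_free (modl l Y) ->
  lequiv l (eigenblock r u s Y z y)
    (diag_mx (row_mx (const_mx (r * s)) (row_mx (const_mx 1) (row_mx (const_mx 0)
      (row_mx (const_mx 1) (const_mx s)))))).
Proof.
move=> u_unit a_unit lam_x a_lam rf_Y; rewrite !diag_mx_row !diag_const_mx.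
have [Z] := row_free_complete erefl rf_Y.
rewrite row_full_unit -/(lunitmx l _) => unitR.
pose Q (W : 'M[int]_(h, h + k)) : 'M[int]_(h + (1 + (1 + (h + k)))) :=
  block_mx r%:M (row_mx 0 (row_mx 0 W)) 0 (block_mx 1%:M 0 0 (block_mx 0 0 0 s%:M)).
apply: (lequiv_trans (B := Q Y)).
  pose Q1 : 'M[int]_(h + (1 + (1 + (h + k)))) :=
    block_mx r%:M (row_mx 0 (row_mx 0 Y)) 0 (block_mx 0 0 (col_mx 1%:M 0) (block_mx 0 0 0 s%:M)).
  apply: (lequiv_trans (B := Q1)).
    pose T : 'M[int]_(h + (1 + (1 + (h + k)))) :=
      block_mx 1%:M 0 0 (block_mx (- u)%:M (row_mx 0 y) 0 1%:M).
    apply: (lequiv_trans (B := Q1 *m T)).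
      have -> : Q1 *m T = block_mx 1%:M 0 0
          (block_mx (a * u)%:M (row_mx (a * r)%:M (u *: x)) 0 1%:M) *m eigenblock r u s Y z y.
        rewrite !blockE.
        rewrite -raddfD /= (_ : a * u * r + a * r * - u = 0) ?raddf0; last by ring.
        rewrite (_ : (a * u) *: z + _ = 0) ?row_mx0 //.
        rewrite addrA [s *: _]scalerA -![(a * _) *: _]scalerA -scalerDr [_ + r *: y]addrC.
        by rewrite lam_x scalerA a_lam -scalerDl mulNr mulrC addNr scale0r.
      apply: lequiv_sym => //; apply: lequiv_mull.
      rewrite !lunitmx_ublock !lunitmx1 lunitmx_scalar // -intr_Fp_eq0 //.
      by rewrite rmorphM mulf_eq0 !intr_Fp_eq0 // negb_or a_unit.
    apply: lequiv_sym => //; apply: lequiv_mulr.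
    by rewrite !lunitmx_ublock ?lunitmx1 ?lunitmx_scalar // dvdzE abszN -dvdzE.
  have -> : Q1 = block_mx 1%:M 0 0 (block_mx 0 (row_mx 1%:M 0) (col_mx 1%:M 0)
      (block_mx 0 0 0 1%:M)) *m Q Y by rewrite !blockE.
  apply: lequiv_mull; rewrite lunitmx_ublock lunitmx1.
  apply: (lunitmx_rinv (T := block_mx 0 (row_mx 1%:M 0) (col_mx 1%:M 0) (block_mx 0 0 0 1%:M))).
  by rewrite !blockE !scalar_mx_block.
apply: (lequiv_trans (B := Q (row_mx 1%:M 0))).
  pose T : 'M[int]_(h + (1 + (1 + (h + k)))) :=
    block_mx 1%:M 0 0 (block_mx 1%:M 0 0 (block_mx 1%:M 0 0 (col_mx Y Z))).
  apply: lequiv_sym => //; exists T, T; rewrite !lunitmx_ublock unitR !lunitmx1; split=> //.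
  by rewrite !blockE.
pose v : 'M[int]_(h, h + k) := row_mx 1%:M 0.
have := @lequiv_hyperbolic h (1 + (1 + (h + k))) r s (row_mx 0 (row_mx 0 v))
  (col_mx 0 (col_mx 0 (col_mx 1%:M 0)))
  (block_mx 1%:M 0 0 (block_mx 0 0 0 (block_mx 1%:M 0 0 s%:M))).
rewrite /v !blockE => /(_ erefl erefl erefl); rewrite -raddfD /= addrC subrK -scalar_mx_block.
by rewrite raddf0.
Qed.

End BlockNormalForms.

(** * Incidence matrices with the Gram matrix of a projective space *)

(* Here N has h + 2 points and b lines, a lines on each point and D points on each
   line; the coordinate ord0 is the point omitted from the basis. *)
Record skew_incidence (l h b : nat) (N : 'M[int]_(1 + (1 + h), b)) (L : 'M[int]_b)
    (a D s : int) : Prop := SkewIncidence {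
  incidence_gram : (N *m N^T = (a - 1)%:M + const_mx 1)%R;
  incidence_row_sum : (N *m const_mx 1 = const_mx a :> 'cV_(1 + (1 + h)))%R;
  incidence_col_sum : (const_mx 1 *m N = const_mx D :> 'rV_b)%R;
  incidence_laplacian : (L = s%:M + N^T *m N - const_mx 1)%R;
  incidence_lines : (b%:Z = s + a * D)%R;
  incidence_points : (h.+2%:Z = 1 + (D - 1) * a)%R;
  incidence_flags : (D * b%:Z = a * h.+2%:Z)%R;
  incidence_indep : forall (v : 'rV['F_l]_(1 + (1 + h))) (c : 'F_l),
    (v ord0 ord0 = 0 -> v *m modl l N = const_mx c -> v = 0)%R }.

Section IncidenceSpectrum.
Variables (l h b : nat) (N : 'M[int]_(1 + (1 + h), b)) (L : 'M[int]_b) (a D s : int).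
Hypothesis l_prime : prime l.
Hypothesis skN : skew_incidence l N L a D s.

Local Open Scope ring_scope.

Let r := s + a - 1.
Let u := a - D.
Let n0 : 'rV_b := usubmx N.
Let n1 : 'rV_b := usubmx (dsubmx N).
Let N2 : 'M_(h, b) := dsubmx (dsubmx N).
Let w : 'cV[int]_h := const_mx 1.
Let o : 'rV[int]_b := const_mx 1.
Let E : 'M_(h, b) := N2 - w *m n1.

Lemma const_mx11 m n : const_mx 1 = (const_mx 1 : 'cV[int]_m) *m (const_mx 1 : 'rV_n).
Proof. by apply/matrixP => i j; rewrite !mxE big_ord1 !mxE. Qed.

Lemma ones_sum m : (const_mx 1 : 'rV[int]_m) *m (const_mx 1 : 'cV_m) = m%:R%:M.
Proof.
apply/matrixP => i j; rewrite !mxE !ord1 mulr1n.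
under eq_bigr do rewrite !mxE mulr1.
by rewrite sumr_const card_ord.
Qed.

Lemma incidence_blocks : N = col_mx n0 (col_mx n1 N2).
Proof. by rewrite !vsubmxK. Qed.

Lemma incidence_gram_blocks :
  [/\ n0 *m n1^T = 1%:M, N2 *m n1^T = w, n0 *m N2^T = w^T &
      N2 *m N2^T = (a - 1)%:M + w *m w^T].
Proof.
have := incidence_gram skN; rewrite incidence_blocks !tr_col_mx !mul_col_row.
rewrite !scalar_mx_block -!block_mx_const !add_block_mx !add0r -row_mx_const.
rewrite mul_mx_row => /eq_block_mx[_ /eq_row_mx[e01 e02] _ /eq_block_mx[_ _ e21 e22]].
split; first by rewrite e01; apply/matrixP => i j; rewrite !mxE !ord1.
- exact: e21.
- by rewrite e02 trmx_const.
by rewrite e22 trmx_const -const_mx11.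
Qed.

Lemma incidence_row_sum_blocks : [/\ n0 *m o^T = a%:M, n1 *m o^T = a%:M & N2 *m o^T = a *: w].
Proof.
have := incidence_row_sum skN; rewrite incidence_blocks !mul_col_mx trmx_const.
rewrite -!col_mx_const => /eq_col_mx[-> /eq_col_mx[-> ->]].
split; apply/matrixP => i j; rewrite !mxE ?ord1 ?mulr1n ?mulr1 //.
Qed.

Lemma incidence_col_sum_blocks : w^T *m N2 = D *: o - n0 - n1.
Proof.
have := incidence_col_sum skN; rewrite incidence_blocks -!row_mx_const !mul_row_col trmx_const.
have onesE (x : 'rV[int]_b) : const_mx 1 *m x = x :> 'rV_b.
  by apply/matrixP => i j; rewrite (ord1 i) !mxE big_ord1 !mxE mul1r.
rewrite !onesE => e.
have -> : D *: o = const_mx D by rewrite scalemx_const mulr1.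
by rewrite -e addrC !addrA addrC !addrA; apply/matrixP => i j; rewrite !mxE; ring.
Qed.

Lemma tr_incidence_ones m : N^T *m const_mx 1 = const_mx D :> 'M_(b, m).
Proof.
have := congr1 trmx (incidence_col_sum skN); rewrite trmx_mul !trmx_const => e.
rewrite const_mx11 mulmxA e; apply/matrixP => i j.
by rewrite !mxE big_ord1 !mxE mulr1.
Qed.

Lemma laplacian_ones : L *m o^T = 0.
Proof.
rewrite (incidence_laplacian skN) mulmxBl mulmxDl mul_scalar_mx -mulmxA trmx_const.
rewrite (incidence_row_sum skN).
have -> : const_mx a = a *: const_mx 1 :> 'cV[int]_(1 + (1 + h)) by rewrite scalemx_const mulr1.
rewrite -scalemxAr tr_incidence_ones (@const_mx11 b b) -mulmxA ones_sum.
have := incidence_lines skN; rewrite natz => ->.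
by rewrite mul_mx_scalar; apply/matrixP => i j; rewrite !mxE; ring.
Qed.

Lemma laplacian_incidence : L *m N^T = r *: N^T - u *: const_mx 1.
Proof.
rewrite (incidence_laplacian skN) mulmxBl mulmxDl mul_scalar_mx -mulmxA (incidence_gram skN).
rewrite mulmxDr mul_mx_scalar tr_incidence_ones.
have -> : const_mx 1 *m N^T = const_mx a :> 'M_(b, 1 + (1 + h)).
  rewrite (@const_mx11 b) -mulmxA.
  have -> : const_mx 1 *m N^T = (const_mx a : 'rV_(1 + (1 + h))).
    by have := congr1 trmx (incidence_row_sum skN); rewrite trmx_mul !trmx_const.
  by apply/matrixP => i j; rewrite !mxE big_ord1 !mxE mul1r.
by apply/matrixP => i j; rewrite !mxE /r /u; ring.
Qed.

Lemma laplacian_blocks :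
  [/\ L *m n1^T = r *: n1^T - u *: o^T & L *m E^T = r *: E^T].
Proof.
have := laplacian_incidence; rewrite incidence_blocks !tr_col_mx !mul_mx_row.
rewrite -!row_mx_const !scale_row_mx !opp_row_mx !add_row_mx.
case/eq_row_mx => _ /eq_row_mx[e1 e2]; split; first by rewrite e1 trmx_const.
rewrite /E linearB /= trmx_mul mulmxBr mulmxA e1 e2 trmx_const mulmxBl -!scalemxAl.
rewrite -const_mx11 scalerBr; apply/matrixP => i j; rewrite !mxE; ring.
Qed.

End IncidenceSpectrum.

Section ValuationCount.
Variable l : nat.
Hypothesis l_prime : prime l.
Local Open Scope ring_scope.

Definition valuation_eq (c : int) (i : nat) : bool := (c != 0) && (logn l `|c|%N == i).

Lemma eldiv_mult_valuation n (c : int) i :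
  eldiv_mult (const_mx c : 'rV_n) l i = (n * valuation_eq c i)%N.
Proof. by rewrite eldiv_mult_const /valuation_eq; case: ifP; rewrite (muln1, muln0). Qed.

Lemma valuation_eq0 i : valuation_eq 0 i = false. Proof. by []. Qed.
Lemma valuation_eq1 i : valuation_eq 1 i = (i == 0%N).
Proof. by rewrite /valuation_eq /= logn1 eq_sym. Qed.

(** Independence of x forces 1 <= g, so g has the form 1 + k and [g - 1] is not truncated;
    [eigenblock_ramified] obtains h <= g from Y in the same way. *)
Lemma eigenblock_unit_r_primitive h g (r u s lam e s' : int)
    (Y : 'M[int]_(h, g)) z y (x : 'rV_g) :
  ~~ (l %| r)%Z -> r *: y + u *: z = lam *: x -> row_free (modl l x) ->
  ~~ (l %| e)%Z -> e * s = lam * s' ->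
  exists2 d' : 'rV_(h + (1 + (1 + g))), lequiv l (eigenblock r u s Y z y) (diag_mx d') &
    forall i, eldiv_mult d' l i =
      (h.+1 * (i == 0) + valuation_eq lam i + (g - 1) * valuation_eq s i)%N.
Proof.
move=> r_unit lam_x rf_x e_unit e_s.
have g_gt0 : (0 < g)%N by move: (rank_leq_col (modl l x)); rewrite (eqP rf_x).
move: (subnKC g_gt0); move: (g - 1)%N => k g_k; subst g.
eexists; first exact: (lequiv_eigenblock_unit_r_primitive l_prime Y r_unit lam_x rf_x e_unit e_s).
move=> i; rewrite !eldiv_mult_row_mx !eldiv_mult_valuation valuation_eq0 valuation_eq1.
by rewrite /= !mul1n ?mulSn; lia.
Qed.

Lemma eigenblock_ramified h g (r u s lam a : int) (Y : 'M[int]_(h, g)) z y x :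
  ~~ (l %| u)%Z -> ~~ (l %| a)%Z -> r *: y + u *: z = lam *: x ->
  a * lam = - u * s -> row_free (modl l Y) ->
  exists2 d' : 'rV_(h + (1 + (1 + g))), lequiv l (eigenblock r u s Y z y) (diag_mx d') &
    forall i, eldiv_mult d' l i =
      (h * valuation_eq (r * s) i + h.+1 * (i == 0) + (g - h) * valuation_eq s i)%N.
Proof.
move=> u_unit a_unit lam_x a_lam rf_Y.
have h_le_g : (h <= g)%N by move: (rank_leq_col (modl l Y)); rewrite (eqP rf_Y).
move: (subnKC h_le_g); move: (g - h)%N => k g_hk; subst g.
eexists; first exact: (lequiv_eigenblock_ramified l_prime u_unit a_unit lam_x a_lam rf_Y).
move=> i; rewrite !eldiv_mult_row_mx !eldiv_mult_valuation valuation_eq0 valuation_eq1.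
by rewrite /= !mul1n ?mulSn; lia.
Qed.

End ValuationCount.

(** * Elementary divisors of the Laplacian from an adapted local basis *)

Section IncidenceElementaryDivisors.
Variables (l h g : nat).
Let b := (h + (1 + (1 + g)))%N.
Variables (N : 'M[int]_(1 + (1 + h), b)) (L : 'M[int]_b) (a D s : int).
Hypothesis l_prime : prime l.
Hypothesis skN : skew_incidence l N L a D s.

Local Open Scope ring_scope.

Let r := s + a - 1.
Let u := a - D.
Let lam := u * D - r.
Let n0 : 'rV_b := usubmx N.
Let n1 : 'rV_b := usubmx (dsubmx N).
Let N2 : 'M_(h, b) := dsubmx (dsubmx N).
Let w : 'cV[int]_h := const_mx 1.
Let o : 'rV[int]_b := const_mx 1.
Let E : 'M_(h, b) := N2 - w *m n1.

Lemma incidence_row_free : row_free (modl l (col_mx E (col_mx n1 o))).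
Proof.
apply: inj_row_free => v.
rewrite -[v]hsubmxK; set v2 := lsubmx v; rewrite -[rsubmx v]hsubmxK.
set v1 := lsubmx _; set c := rsubmx _.
rewrite /modl !map_col_mx -!/(modl l _) !mul_row_col => v0.
(* Coefficients of the relation on N_0, N_1 and the other rows: each difference N_i - N_1 takes its
   coefficient away from N_1, and N_0 does not occur. *)
pose V : 'rV['F_l]_(1 + (1 + h)) := row_mx 0 (row_mx (v1 - v2 *m modl l w) v2).
have : V = 0.
  apply: (incidence_indep skN (c := - c ord0 ord0)).
    by rewrite mxE; case: splitP => // j _; rewrite mxE.
  rewrite (incidence_blocks N) /modl !map_col_mx -!/(modl l _) !mul_row_col mul0mx add0r.
  have -> : const_mx (- c ord0 ord0) = - (c *m modl l o).
    by apply/matrixP => i j; rewrite /modl !mxE big_ord1 !mxE rmorph1 mulr1 (ord1 i).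
  apply/eqP; rewrite -addr_eq0 -v0 /E modlB modlM mulmxBr mulmxA.
  by rewrite mulmxBl; apply/eqP/matrixP => i j; rewrite !mxE; ring.
move/eqP; rewrite !row_mx_eq0 => /and3P[_ v1_0 /eqP v2_0].
move: v0 v1_0; rewrite v2_0 !mul0mx subr0 add0r => v0 /eqP v1_0.
move: v0; rewrite v1_0 mul0mx add0r => /matrixP/(_ ord0 (rshift h (lshift (1 + g) ord0))).
rewrite !mxE big_ord1 !mxE rmorph1 mulr1 => c0.
by rewrite (_ : c = 0) ?row_mx0 //; apply/matrixP => i j; rewrite (ord1 i) (ord1 j) !mxE c0.
Qed.

Section Eigenbasis.
Variable Z : 'M[int]_(g, b).

Definition eigen_basis : 'M[int]_b := col_mx E (col_mx n1 (col_mx o Z)).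

Let x := o *m Z^T.
Let z := D *: x - h.+2%:R *: (n0 *m Z^T).
Let y := D *: (n0 *m Z^T) - x.
Let Y := (N2 - w *m n0) *m Z^T.

(** Eliminating n0^T by n0^T = D o^T - n1^T - N2^T w, and writing N2 = E + w n1, expresses N^T N - J
    through E^T, n1^T and o^T. The three cofactors, multiplied by Z^T, are the blocks Y, z and y. *)
Lemma laplacian_eigen_basis :
  L *m eigen_basis^T = eigen_basis^T *m eigenblock r u s Y z y.
Proof.
have [Ln1 LE] := laplacian_blocks skN; have Lo := laplacian_ones skN.
rewrite /eigen_basis /eigenblock !tr_col_mx !mul_mx_row !blockE.
rewrite LE Ln1 Lo scaleNr; do 3!congr row_mx.
have colN := incidence_col_sum_blocks skN; have := congr1 trmx colN.
rewrite trmx_mul trmxK 2!linearB linearZ /= => colN'.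
have w_w : w^T *m w = h%:R%:M by rewrite trmx_const ones_sum.
have JE : const_mx 1 = o^T *m o :> 'M_b by rewrite trmx_const -const_mx11.
have NNE : N^T *m N = n0^T *m n0 + (n1^T *m n1 + N2^T *m N2).
  by rewrite {1 2}(incidence_blocks N) !tr_col_mx !mul_row_col.
have key : E^T *m (N2 - w *m n0) + n1^T *m (D *: o - h.+2%:R *: n0) + o^T *m (D *: n0 - o) =
    N^T *m N - const_mx 1.
  rewrite JE NNE /E [(_ - _)^T]linearB /= trmx_mul mulmxBr !mulmxBl !mulmxA colN'.
  rewrite -!(mulmxA n1^T w^T) colN w_w mul_mx_scalar.
  rewrite !(mulmxBl, mulmxBr) -!(scalemxAl, scalemxAr).
  move: (n0^T *m n0) (n1^T *m n1) (N2^T *m N2) (o^T *m n0) (n1^T *m o) (n1^T *m n0) (o^T *m o).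
  by move=> A1 A2 A3 A4 A5 A6 A7; apply/matrixP => i j; rewrite !mxE; ring.
rewrite (incidence_laplacian skN) -addrA -key mulmxDl mul_scalar_mx addrC !mulmxDl.
rewrite -!mulmxA !addrA; congr (_ + _ + _ + _); congr (_ *m _).
  by rewrite mulmxBl -!scalemxAl.
by rewrite mulmxBl -!scalemxAl.
Qed.

(** The terms in n0 Z^T cancel because D r = u P with P the number of points, which combines the
    counts of lines, points and flags. *)
Lemma eigenblock_relation : r *: y + u *: z = lam *: x.
Proof.
have := incidence_points skN; have := incidence_flags skN; have := incidence_lines skN.
rewrite -!natz => -> flags points.
have rD : D * r = u * h.+2%:R.
  rewrite (_ : D * r = D * (s + a * D) - a * D * D + D * a - D); last by rewrite /r; ring.
  by rewrite flags /u points; ring.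
rewrite /y /z; move: x (n0 *m Z^T) => x' t; apply/matrixP => i j; rewrite !mxE.
rewrite (_ : _ + _ = (u * D - r) * x' i j + (D * r - u * h.+2%:R) * t i j); last by ring.
by rewrite rD subrr mul0r addr0.
Qed.

Lemma ones_eigen_basis :
  o *m eigen_basis^T = row_mx 0 (row_mx a%:M (row_mx b%:Z%:M x)).
Proof.
have [_ n1o N2o] := incidence_row_sum_blocks skN.
rewrite /eigen_basis !tr_col_mx !mul_mx_row; congr row_mx.
  rewrite -[o]trmxK -trmx_mul /E mulmxBl N2o -mulmxA n1o mul_mx_scalar subrr.
  by rewrite trmx0.
congr row_mx; first by rewrite -[o]trmxK -trmx_mul n1o tr_scalar_mx.
by rewrite trmx_const ones_sum natz.
Qed.

(** The constant part of the Gram matrix cancels between the two base points. The scalar block that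
    remains vanishes mod l when l divides a - 1, and then only Y is left. *)
Lemma differences_eigen_basis :
  (N2 - w *m n0) *m eigen_basis^T = row_mx (a - 1)%:M (row_mx 0 (row_mx 0 Y)).
Proof.
have [_ n1o N2o] := incidence_row_sum_blocks skN.
have [n0o _ _] := incidence_row_sum_blocks skN.
have [n01 N2n1 n0N2 N22] := incidence_gram_blocks skN.
rewrite /eigen_basis !tr_col_mx !mul_mx_row; congr row_mx.
  rewrite /E linearB /= trmx_mul mulmxBr !mulmxBl !mulmxA N2n1 N22 -(mulmxA w) n0N2.
  by rewrite -(mulmxA w) n01 mulmx1 addrK subrr subr0.
congr row_mx; first by rewrite mulmxBl N2n1 -mulmxA n01 mulmx1 subrr.
by rewrite mulmxBl N2o -mulmxA n0o mul_mx_scalar subrr.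
Qed.

Lemma lequiv_laplacian : lunitmx l eigen_basis -> lequiv l L (eigenblock r u s Y z y).
Proof.
move=> unitU; exists eigen_basis^T, eigen_basis^T.
by split; rewrite ?lunitmx_tr //; exact: laplacian_eigen_basis.
Qed.

Lemma eigen_basis_eq0 (v : 'rV['F_l]_b) :
  lunitmx l eigen_basis -> v *m modl l eigen_basis^T = 0 -> v = 0.
Proof.
move=> unitU vU0; have unitUt : lunitmx l eigen_basis^T by rewrite lunitmx_tr.
by rewrite -[v](mulmxK unitUt) vU0 mul0mx.
Qed.

(* If l divides a and b, the all-one vector is orthogonal mod l to all of the
   basis except Z, so it cannot be orthogonal to Z as well. *)
Lemma ones_primitive : lunitmx l eigen_basis -> (l %| a)%Z -> (l %| s)%Z -> row_free (modl l x).
Proof.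
move=> unitU l_a l_s; apply: inj_row_free => v vx0.
have l_b : (l %| b%:Z)%Z by rewrite (incidence_lines skN) rpredD // dvdz_mulr.
have : v *m modl l o = 0.
  apply: (eigen_basis_eq0 unitU); rewrite -mulmxA -modlM ones_eigen_basis.
  rewrite /modl !map_row_mx !map_scalar_mx -/(modl l x) !mul_mx_row vx0.
  move: l_a l_b; rewrite -!intr_Fp_eq0 // => /eqP /= -> /eqP /= ->.
  by rewrite !(map_mx0, raddf0, mulmx0, row_mx0).
move/matrixP => vo0; apply/matrixP => i j.
have := vo0 i (rshift h (lshift _ ord0)); rewrite /modl !mxE big_ord1 !mxE rmorph1 mulr1.
by rewrite (ord1 j).
Qed.

(* A vector of the span of the N_i - N_0 annihilated by Z is orthogonal mod l to the
   whole basis, hence zero; as l divides D, the row N_0 is minus the sum of the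
   others mod l, which turns this into a relation avoiding N_0. *)
Lemma differences_row_free : lunitmx l eigen_basis ->
  (l %| a - 1)%Z -> (l %| D)%Z -> row_free (modl l Y).
Proof.
move=> unitU l_a1 l_D; apply: inj_row_free => v vY0.
have : v *m modl l (N2 - w *m n0) = 0.
  apply: (eigen_basis_eq0 unitU); rewrite -mulmxA -modlM differences_eigen_basis.
  rewrite /modl !map_row_mx map_scalar_mx -/(modl l Y) !mul_mx_row vY0.
  move: l_a1; rewrite -!intr_Fp_eq0 // => /eqP /= ->.
  by rewrite !(map_mx0, raddf0, mulmx0, row_mx0).
rewrite modlB modlM mulmxBr mulmxA; set c := v *m modl l w => vN0.
have D0 : modl l (w^T *m N2) = - modl l n0 - modl l n1.
  rewrite (incidence_col_sum_blocks skN) !modlB modlZ.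
  by move: l_D; rewrite -intr_Fp_eq0 // => /eqP ->; rewrite scale0r sub0r.
have cn0 : c *m modl l n0 = - (c *m modl l n1 + c *m modl l w^T *m modl l N2).
  by rewrite -mulmxA -modlM D0 mulmxBr mulmxN addrCA subrr addr0 opprK.
pose V : 'rV['F_l]_(1 + (1 + h)) := row_mx 0 (row_mx c (v + c *m modl l w^T)).
have : V = 0.
  apply: (incidence_indep skN (c := 0)).
    by rewrite mxE; case: splitP => // j _; rewrite mxE.
  rewrite (incidence_blocks N) /modl !map_col_mx -!/(modl l _) !mul_row_col mul0mx add0r.
  by move: vN0; rewrite cn0 opprK mulmxDl addrCA => ->.
move/eqP; rewrite !row_mx_eq0 => /and3P[_ /eqP c0 /eqP].
by rewrite c0 mul0mx addr0.
Qed.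

End Eigenbasis.

Lemma exists_eigen_basis : exists Z, lunitmx l (eigen_basis Z).
Proof.
have [|Z full] := @row_free_complete l _ g b _ _ incidence_row_free.
  by rewrite /b; lia.
exists Z; rewrite /lunitmx -row_full_unit -sub1mx.
move: full; rewrite -sub1mx => /submx_trans; apply.
have := submx_refl (modl l (eigen_basis Z)).
rewrite {1}/eigen_basis /modl !map_col_mx !col_mx_sub => /and4P[-> -> -> ->].
by [].
Qed.

Variable d : 'rV[int]_b.
Hypothesis d_smith : smith_diagonal L d.

Lemma eldiv_mult_unit_s i : ~~ (l %| s)%Z ->
  eldiv_mult d l i = (h * valuation_eq l r i + valuation_eq l (gcdz r u) i + g * (i == 0))%N.
Proof.
move=> s_unit; have [Z unitU] := exists_eigen_basis.
have eq_d := lequiv_trans (lequiv_laplacian unitU)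
  (lequiv_eigenblock_unit_s l_prime r u _ _ _ s_unit).
rewrite (smith_diagonal_eldiv_mult l_prime d_smith eq_d).
rewrite !eldiv_mult_row_mx !eldiv_mult_valuation valuation_eq0 valuation_eq1 /=.
by rewrite !mul1n ?mulSn; lia.
Qed.

Lemma eldiv_mult_unit_r_absorb (e s' : int) i :
  ~~ (l %| r)%Z -> ~~ (l %| e)%Z -> e * lam = s * s' ->
  eldiv_mult d l i = (h.+1 * (i == 0) + g * valuation_eq l s i)%N.
Proof.
move=> r_unit e_unit e_lam; have [Z unitU] := exists_eigen_basis.
have eq_d := lequiv_trans (lequiv_laplacian unitU)
  (lequiv_eigenblock_unit_r_absorb l_prime _ r_unit (eigenblock_relation Z) e_unit e_lam).
rewrite (smith_diagonal_eldiv_mult l_prime d_smith eq_d).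
rewrite !eldiv_mult_row_mx !eldiv_mult_valuation valuation_eq0 valuation_eq1.
by rewrite /= !mul1n ?mulSn; lia.
Qed.

Lemma eldiv_mult_unit_r_primitive (e s' : int) i :
  ~~ (l %| r)%Z -> ~~ (l %| e)%Z -> (l %| a)%Z -> (l %| s)%Z -> e * s = lam * s' ->
  eldiv_mult d l i = (h.+1 * (i == 0) + valuation_eq l lam i + (g - 1) * valuation_eq l s i)%N.
Proof.
move=> r_unit e_unit l_a l_s e_s; have [Z unitU] := exists_eigen_basis.
have [d' Bd' <-] := eigenblock_unit_r_primitive l_prime ((N2 - w *m n0) *m Z^T) r_unit
  (eigenblock_relation Z) (ones_primitive unitU l_a l_s) e_unit e_s.
apply: (smith_diagonal_eldiv_mult l_prime d_smith).
exact: lequiv_trans (lequiv_laplacian unitU) Bd'.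
Qed.

Lemma eldiv_mult_ramified i :
  ~~ (l %| u)%Z -> ~~ (l %| a)%Z -> (l %| a - 1)%Z -> (l %| D)%Z -> a * lam = - u * s ->
  eldiv_mult d l i =
    (h * valuation_eq l (r * s) i + h.+1 * (i == 0) + (g - h) * valuation_eq l s i)%N.
Proof.
move=> u_unit a_unit l_a1 l_D a_lam; have [Z unitU] := exists_eigen_basis.
have [d' Bd' <-] := eigenblock_ramified l_prime u_unit a_unit
  (eigenblock_relation Z) a_lam (differences_row_free unitU l_a1 l_D).
apply: (smith_diagonal_eldiv_mult l_prime d_smith).
exact: lequiv_trans (lequiv_laplacian unitU) Bd'.
Qed.

End IncidenceElementaryDivisors.

(** * Points, lines and planes *)

Lemma qintE q m : 1 < q -> qint q m * (q - 1) = q ^ m - 1.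
Proof. by move=> q_gt1; rewrite /qint divnK // !subn1 predn_exp dvdn_mulr. Qed.

Lemma qintS q m : 1 < q -> qint q m.+1 = 1 + q * qint q m.
Proof.
move=> q_gt1; have q1_gt0 : 0 < q - 1 by rewrite subn_gt0.
apply/eqP; rewrite -(eqn_pmul2r q1_gt0) qintE // mulnDl mul1n -mulnA qintE //.
have qm_gt0 : 0 < q ^ m by rewrite expn_gt0 ltnW.
by rewrite expnS; apply/eqP; nia.
Qed.

Lemma qint0 q : qint q 0 = 0. Proof. by rewrite /qint subnn div0n. Qed.

Lemma qint1 q : 1 < q -> qint q 1 = 1.
Proof. by move=> q_gt1; rewrite qintS // qint0 muln0. Qed.

Lemma qint2 q : 1 < q -> qint q 2 = q + 1.
Proof. by move=> q_gt1; rewrite qintS // qint1 // muln1 addnC. Qed.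

Section Subspaces.
Variables (F : finFieldType) (V : vectType F).
Implicit Types U W P Q : {vspace V}.
Local Notation q := #|F|.

Lemma card_finvect U : #|[pred v : finvect_type V | (v : V) \in U]| = q ^ \dim U.
Proof.
case: V U => T c U; rewrite -(@card_vspace F (finvect_type (Vector.Pack c)) c U).
exact: eq_card.
Qed.

(** Nonzero vectors of W are fibred over the points they span, q - 1 over each. *)
Lemma card_points W : #|[pred P : {vspace V} | (\dim P == 1) && (P <= W)%VS]| = qint q (\dim W).
Proof.
have q_gt1 := card_finNzRing_gt1 F.
have q1_gt0 : 0 < q - 1 by rewrite subn_gt0.
have card_nonzero U : \sum_(v : finvect_type V | (v \in U) && (v != 0%R)) 1 = q ^ \dim U - 1.
  rewrite -card_finvect sum1_card [in RHS](cardD1 0%R) inE mem0v addKn.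
  by apply: eq_card => v; rewrite !inE andbC.
apply/eqP; rewrite -(eqn_pmul2r q1_gt0) qintE // -card_nonzero -sum1_card big_distrl /=.
rewrite [eqbRHS](partition_big (fun v : finvect_type V => <[v : V]>%VS)
  [pred P : {vspace V} | (\dim P == 1) && (P <= W)%VS]) /=; last first.
  by move=> v /andP[vW v0]; rewrite dim_vline v0 -memvE.
apply/eqP/eq_big => // P; rewrite mul1n => /andP[/eqP dimP PW].
have := card_nonzero P; rewrite dimP expn1 => <-; apply: eq_bigl => v.
apply/andP/andP => [[vP v0]|[/andP[vW v0] /eqP <-]]; last by rewrite memv_line.
rewrite (subvP PW) // v0; split=> //.
by rewrite eqEdim -memvE vP dimP dim_vline v0.
Qed.

Lemma dim_join_points P Q : \dim P == 1 -> \dim Q == 1 -> P != Q -> \dim (P + Q) = 2.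
Proof.
move=> /eqP dimP /eqP dimQ PQ; have := dimv_sum_cap P Q; rewrite dimP dimQ => e.
have : \dim (P :&: Q) != 1.
  apply: contra PQ => /eqP dimPQ.
  have /eqP <- : (P :&: Q == P)%VS by rewrite eqEdim capvSl dimPQ dimP.
  by rewrite eqEdim capvSr dimPQ dimQ.
have := dimvS (capvSl P Q); rewrite dimP; move: e.
by case: (\dim (P :&: Q)) => [|[]] //; rewrite addn0.
Qed.

Lemma line_through P Q U : \dim P == 1 -> \dim Q == 1 -> P != Q ->
  (\dim U == 2) && ((P <= U)%VS && (Q <= U)%VS) = (U == (P + Q)%VS).
Proof.
move=> dimP dimQ PQ; have dimPQ := dim_join_points dimP dimQ PQ.
apply/andP/eqP => [[/eqP dimU]|->]; last by rewrite dimPQ addvSl addvSr.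
by rewrite -subv_add => PQU; apply/esym/eqP; rewrite eqEdim PQU dimPQ dimU.
Qed.

(** The points of W other than P are fibred over their joins with P, and each line through P carries
    q of them. *)
Lemma card_lines_through P W : \dim P == 1 -> (P <= W)%VS ->
  #|[pred U : {vspace V} | (\dim U == 2) && ((P <= U)%VS && (U <= W)%VS)]| = qint q (\dim W - 1).
Proof.
move=> dimP PW; have q_gt1 := card_finNzRing_gt1 F.
have dimW : 0 < \dim W by rewrite -(eqP dimP) dimvS.
have other U : (P <= U)%VS ->
    \sum_(Q : {vspace V} | ((\dim Q == 1) && (Q <= U)%VS) && (Q != P)) 1 = qint q (\dim U) - 1.
  move=> PU; rewrite -card_points sum1_card [in RHS](cardD1 P) inE dimP PU addKn.
  by apply: eq_card => Q; rewrite !inE andbC.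
have := other W PW; rewrite (partition_big (fun Q => (P + Q)%VS)
  [pred U : {vspace V} | (\dim U == 2) && ((P <= U)%VS && (U <= W)%VS)]) /=; last first.
  move=> Q /andP[/andP[dimQ QW] QP]; rewrite eq_sym in QP.
  by rewrite (dim_join_points dimP dimQ QP) addvSl subv_add PW QW.
rewrite (eq_bigr (fun=> q)); last first.
  move=> U /andP[/eqP dimU /andP[PU UW]].
  rewrite -[RHS](_ : qint q (\dim U) - 1 = _); last by rewrite dimU qint2 // addnK.
  rewrite -other //; apply: eq_bigl => Q.
  apply/andP/andP => [[/andP[/andP[dimQ QW] QP] /eqP <-]|[/andP[dimQ QU] QP]].
    by rewrite dimQ addvSr QP.
  rewrite dimQ QP (subv_trans QU UW); split=> //; rewrite eq_sym in QP.
  by rewrite eq_sym -(line_through U dimP dimQ QP) dimU PU QU.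
have dimWE : \dim W = (\dim W - 1).+1 by rewrite subn1 prednK.
rewrite sum_nat_const {1}dimWE qintS // addKn mulnC => /eqP.
by rewrite eqn_pmul2l ?(ltnW q_gt1) // => /eqP.
Qed.

(** Double counting of the flags inside W. *)
Lemma card_lines W :
  #|[pred U : {vspace V} | (\dim U == 2) && (U <= W)%VS]| * (q + 1) =
  qint q (\dim W) * qint q (\dim W - 1).
Proof.
have q_gt1 := card_finNzRing_gt1 F.
rewrite -sum1_card big_distrl /=.
transitivity (\sum_(U : {vspace V} | (\dim U == 2) && (U <= W)%VS)
   \sum_(P : {vspace V} | (\dim P == 1) && (P <= U)%VS) 1).
  apply: eq_bigr => U /andP[/eqP dimU _].
  by rewrite sum1_card card_points dimU qint2 // mul1n.
rewrite (exchange_big_dep [pred P : {vspace V} | (\dim P == 1) && (P <= W)%VS]) /=; last first.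
  by move=> U P /andP[_ UW] /andP[-> PU]; rewrite (subv_trans PU).
rewrite -card_points -sum_nat_const; apply: eq_bigr => P /andP[dimP PW].
rewrite sum1_card -(card_lines_through dimP PW); apply: eq_card => U.
rewrite !inE dimP unfold_in /=.
by case: (\dim U == 2); case: (P <= U)%VS; case: (U <= W)%VS.
Qed.

(** P = Q is allowed: the plane will join an arbitrary point to the omitted one, and the two may
    coincide. *)
Lemma plane_through P Q : \dim P == 1 -> \dim Q == 1 -> 3 <= \dim {:V} ->
  exists W, [/\ (P <= W)%VS, (Q <= W)%VS & \dim W = 3].
Proof.
move=> dimP dimQ dimV.
have extend U : \dim U < \dim {:V} -> exists2 W, (U <= W)%VS & \dim W = (\dim U).+1.
  move=> dimU; have /subvPn[v _ vU] : ~~ (fullv <= U)%VS.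
    by apply: contraL dimU => /dimvS; rewrite -leqNgt.
  exists (U + <[v]>)%VS; first exact: addvSl.
  rewrite dimv_disjoint_sum ?dim_vline; last first.
    apply/eqP; rewrite -subv0; apply/subvP => x; rewrite memv_cap => /andP[xU /vlineP[k xk]].
    have [k0|k0] := eqVneq k 0%R; first by rewrite xk k0 scale0r mem0v.
    case/negP: vU; rewrite -[v]scale1r -(mulVf k0) -scalerA -xk.
    by rewrite memvZ.
  by have -> : v != 0%R; [apply: contraNneq vU => ->; rewrite mem0v | rewrite addn1].
have [U [PU QU dimU]] : exists U, [/\ (P <= U)%VS, (Q <= U)%VS & \dim U = 2].
  have [PQ|PQ] := eqVneq P Q.
    have [|U PU dimU] := extend P; first by rewrite (eqP dimP) (leq_trans _ dimV).
    by exists U; rewrite -PQ PU dimU (eqP dimP).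
  by exists (P + Q)%VS; rewrite addvSl addvSr dim_join_points.
have [|W UW dimW] := extend U; first by rewrite dimU.
by exists W; rewrite (subv_trans PU UW) (subv_trans QU UW) dimW dimU.
Qed.

End Subspaces.

Lemma card_lineE (F : finFieldType) (V : vectType F) :
  #|line V| * (#|F| + 1) = qint #|F| (\dim {:V}) * qint #|F| (\dim {:V} - 1).
Proof.
rewrite -card_lines card_sub; congr (_ * _); apply: eq_card => U.
by rewrite !inE subvf andbT.
Qed.

Lemma qbinom2E (F : finFieldType) m :
  qbinom F m 2 * (#|F| + 1) = qint #|F| m * qint #|F| (m - 1).
Proof.
have := @card_lines F 'rV[F]_m fullv; rewrite dimvf /dim /= mul1n => <-.
by congr (_ * _); apply: eq_card => U; rewrite !inE subvf andbT.
Qed.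

(** * The point-line incidence matrix of V *)

Section IncidenceMatrix.
Variables (F : finFieldType) (V : vectType F) (l h : nat).
Local Notation q := #|F|.
Local Notation n := (\dim {:V}).
Hypothesis l_prime : prime l.
Hypothesis l_q : ~~ (l %| q).
Hypothesis n_ge3 : 3 <= n.
Hypothesis hE : qint q n = 1 + (1 + h).

Let points : pred {vspace V} := [pred P | \dim P == 1].

Lemma card_all_points : #|points| = 1 + (1 + h).
Proof. by rewrite -hE -card_points; apply: eq_card => P; rewrite !inE subvf andbT. Qed.

Let pt (i : 'I_(1 + (1 + h))) : {vspace V} := enum_val (cast_ord (esym card_all_points) i).
Let ln (j : 'I_#|line V|) : {vspace V} := val (enum_val j).

Lemma dim_pt i : \dim (pt i) == 1.
Proof. exact: (enum_valP (cast_ord (esym card_all_points) i)). Qed.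

Lemma dim_ln j : \dim (ln j) == 2.
Proof. exact: (valP (enum_val j)). Qed.

Lemma pt_inj : injective pt.
Proof. by move=> i j /enum_val_inj/cast_ord_inj. Qed.

Lemma ln_inj : injective ln.
Proof. by move=> i j /val_inj/enum_val_inj. Qed.

Local Open Scope ring_scope.

Lemma sum_pt (R : nmodType) (G : {vspace V} -> R) :
  \sum_(P : {vspace V} | \dim P == 1%N) G P = \sum_i G (pt i).
Proof.
rewrite (big_enum_val (A := points)) (reindex (cast_ord (esym card_all_points))) //.
by exists (cast_ord card_all_points) => i _; rewrite ?cast_ordK ?cast_ordKV.
Qed.

Lemma sum_ln (R : nmodType) (G : {vspace V} -> R) :
  \sum_(U : {vspace V} | \dim U == 2%N) G U = \sum_j G (ln j).
Proof.
by rewrite (big_sub [pred U : {vspace V} | \dim U == 2%N]) (big_enum_val (A := line V)).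
Qed.

Lemma sumr_pred (R : pzSemiRingType) (I : finType) (P Q : pred I) :
  \sum_(i | P i) (Q i)%:R = #|[pred i | P i && Q i]|%:R :> R.
Proof.
rewrite -sum1_card natr_sum big_mkcondr; apply: eq_bigr => i _.
by case: (Q i).
Qed.

Definition incidence_mx : 'M[int]_(1 + (1 + h), #|line V|) :=
  \matrix_(i, j) ((pt i <= ln j)%VS)%:R.

Lemma sum_lines_through (R : pzSemiRingType) i k :
  \sum_j ((pt i <= ln j)%VS && (pt k <= ln j)%VS)%:R =
  (if i == k then qint q (n - 1) else 1%N)%:R :> R.
Proof.
rewrite -(sum_ln (fun U => ((pt i <= U)%VS && (pt k <= U)%VS)%:R)) sumr_pred; congr _%:R.
have [<-|ik] := eqVneq i k.
  rewrite -(card_lines_through (dim_pt i) (subvf _)).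
  by apply: eq_card => U; rewrite !inE andbb subvf andbT.
transitivity #|pred1 (pt i + pt k)%VS|; last exact: card1.
by apply: eq_card => U; rewrite !inE line_through ?dim_pt // (inj_eq pt_inj).
Qed.

Lemma incidence_independent (v : 'rV['F_l]_(1 + (1 + h))) c :
  v ord0 ord0 = 0 -> v *m modl l incidence_mx = const_mx c -> v = 0.
Proof.
move=> v0 vN.
(* Summing the relation over the lines of a plane W through a point i counts i
   q + 1 times and the other points of W once. *)
have line_sum U : \dim U == 2%N -> \sum_(k | (pt k <= U)%VS) v ord0 k = c.
  move=> dimU; pose j := enum_rank (Sub U dimU : line V).
  have lnj : ln j = U by rewrite /ln enum_rankK.
  have := congr1 (fun M : 'rV_#|line V| => M ord0 j) vN; rewrite !mxE => <-.
  rewrite big_mkcond; apply: eq_bigr => k _; rewrite !mxE lnj.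
  by case: (pt k <= U)%VS; rewrite ?rmorph1 ?rmorph0 ?mulr1 ?mulr0.
have plane_sum (W : {vspace V}) i : \dim W = 3 -> (pt i <= W)%VS ->
    \sum_(k | (pt k <= W)%VS) v ord0 k + q%:R * v ord0 i = (q + 1)%:R * c.
  move=> dimW iW; pose on U := (\dim U == 2%N) && ((pt i <= U)%VS && (U <= W)%VS).
  have <- : \sum_(U | on U) \sum_(k | (pt k <= U)%VS) v ord0 k = (q + 1)%:R * c.
    rewrite (eq_bigr (fun=> c)) => [|U /andP[dimU _]]; last exact: line_sum.
    rewrite sumr_const (card_lines_through (dim_pt i) iW) dimW qint2 ?card_finNzRing_gt1 //.
    by rewrite mulr_natl.
  rewrite (exchange_big_dep (fun k => (pt k <= W)%VS)) /=; last first.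
    by move=> U k /andP[_ /andP[_ UW]] /subv_trans; apply.
  have inner k : (pt k <= W)%VS -> \sum_(U | on U && (pt k <= U)%VS) v ord0 k =
      v ord0 k + (k == i)%:R * (q%:R * v ord0 i).
    move=> kW; rewrite sumr_const; have [->|ki] := eqVneq k i.
      rewrite mul1r (_ : _ + _ = (q + 1)%:R * v ord0 i); last first.
        by rewrite natrD mulrDl mul1r addrC.
      have := card_lines_through (dim_pt i) iW.
      rewrite dimW qint2 ?card_finNzRing_gt1 // => <-; rewrite mulr_natl; congr (_ *+ _).
      apply: eq_card => U; rewrite !inE unfold_in /on /=.
      by case: (pt i <= U)%VS; rewrite ?andbT ?andbF.
    rewrite mul0r addr0 (_ : #|_| = 1%N) ?mulr1n //.
    transitivity #|pred1 (pt i + pt k)%VS|; last exact: card1.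
    have ik : pt i != pt k by rewrite (inj_eq pt_inj) eq_sym.
    apply: eq_card => U; rewrite !inE -(line_through U (dim_pt i) (dim_pt k) ik) unfold_in /on /=.
    apply/idP/idP => [/andP[/and3P[-> -> _] ->] //|Uik]; case/and3P: (Uik) => -> -> -> /=.
    move: Uik; rewrite line_through ?dim_pt // => /eqP->.
    by rewrite subv_add iW kW.
  rewrite [RHS](eq_bigr _ inner) big_split /=; congr (_ + _).
  rewrite (bigD1 i) //= eqxx mul1r big1 ?addr0 // => k /andP[_ /negPf->].
  by rewrite mul0r.
have q_neq0 : (q%:R : 'F_l) != 0 by have := @intr_Fp_eq0 l l_prime q => /= ->.
apply/matrixP => j i; rewrite (ord1 j) mxE.
(* Comparing the plane sums at i and at the omitted point leaves q v_i = q v_0 = 0, and q is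
   invertible mod l. *)
have [W [iW W0 dimW]] := plane_through (dim_pt i) (dim_pt ord0) n_ge3.
have := plane_sum W i dimW iW; rewrite -(plane_sum W ord0 dimW W0) v0 mulr0 => /addrI/eqP.
by rewrite mulf_eq0 (negPf q_neq0) => /eqP.
Qed.

(** An entry of N^T N counts common points: q + 1 on the diagonal, 1 for distinct meeting lines, 0
    for skew ones. Hence N^T N = q I + J - A, which makes s the valency minus q. *)
Lemma skew_incidenceP :
  skew_incidence l incidence_mx (skew_laplacian V) (qint q (n - 1))%:R (q + 1)%:R
    ((skew_valency V)%:R - q%:R).
Proof.
have q_gt1 := card_finNzRing_gt1 F.
split.
- apply/matrixP => i k; rewrite !mxE.
  under eq_bigr do rewrite !mxE -natrM mulnb.
  by rewrite sum_lines_through; case: eqP => // _; rewrite ?mulr1n ?mulr0n ?add0r ?subrK.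
- apply/matrixP => i k; rewrite !mxE.
  have := sum_lines_through int i i; rewrite eqxx => <-.
  by apply: eq_bigr => j _; rewrite !mxE mulr1 andbb.
- apply/matrixP => i j; rewrite !mxE.
  under eq_bigr do rewrite !mxE mul1r.
  rewrite -(sum_pt (fun P => ((P <= ln j)%VS)%:R)) sumr_pred card_points (eqP (dim_ln j)).
  by rewrite qint2.
- apply/matrixP => j k; rewrite !mxE.
  under [X in _ + X - _]eq_bigr do rewrite !mxE -natrM mulnb -subv_cap.
  rewrite -(sum_pt (fun P => ((P <= ln j :&: ln k)%VS)%:R : int)) sumr_pred card_points /Defs.skew.
  rewrite -/(ln j) -/(ln k).
  have [<-|jk] := eqVneq j k.
    rewrite capvv -dimv_eq0 (eqP (dim_ln j)) qint2 // natrD !mulr1n /=; ring.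
  have : \dim (ln j :&: ln k)%VS != 2%N.
    apply: contra jk => /eqP dim2; apply/eqP/ln_inj/eqP.
    have /eqP {1}<- : (ln j :&: ln k == ln j)%VS by rewrite eqEdim capvSl dim2 (eqP (dim_ln j)).
    by rewrite eqEdim capvSr dim2 (eqP (dim_ln k)).
  have := dimvS (capvSl (ln j) (ln k)); rewrite -dimv_eq0 (eqP (dim_ln j)).
  by case: (\dim _) => [|[|[]]] //; rewrite ?qint0 ?qint1 // !mulr0n /= ?subr0 ?subrr ?add0r.
- have nE m : (m < n)%N -> qint q (n - m) = (1 + q * qint q (n - m.+1))%N.
    by move=> mn; rewrite -qintS // subnSK.
  (* Geometrically, a line meets 1 + (q + 1)([n-1] - 1) lines, itself included. The identity is
     checked from the closed formulas, multiplied by q + 1 and written in terms of [n-3]. *)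
  suff e : (#|line V| + q = skew_valency V + qint q (n - 1) * (q + 1))%N.
    rewrite -natz (_ : #|line V|%:R = (#|line V| + q)%:R - q%:R :> int); last first.
      by rewrite natrD addrK.
    by rewrite e natrD natrM; ring.
  apply/eqP; rewrite -(eqn_pmul2r (m := (q + 1)%N)) ?addn1 // -addn1 !mulnDl /skew_valency.
  have e0 : qint q n = (1 + q * qint q (n - 1))%N by rewrite -(nE 0%N) ?subn0 //; lia.
  have e1 : qint q (n - 1) = (1 + q * qint q (n - 2))%N by rewrite (nE 1%N) //; lia.
  have e2 : qint q (n - 2) = (1 + q * qint q (n - 3))%N by rewrite (nE 2%N).
  rewrite card_lineE -(mulnA (q ^ 4)%N) qbinom2E -subnDA -[(2 + 1)%N]/3%N e0 e1 e2.
  by move: (qint q _) => A; apply/eqP; ring.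
- rewrite -natz -addn2 (_ : (h + 2 = qint q n)%N); last by rewrite hE; lia.
  rewrite -[in qint q n](subnK (_ : 1 <= n)%N) ?addn1 ?qintS //; last by lia.
  by rewrite !natrD natrM; ring.
- by rewrite -!natz -!natrM mulnC card_lineE hE mulnC.
- exact: incidence_independent.
Qed.

End IncidenceMatrix.

(** * The critical group *)

Section CokernelTorsion.
Variables (n : nat) (M : 'M[int]_n) (d : 'rV[int]_n).
Hypothesis d_smith : smith_diagonal M d.
Local Open Scope quotient_scope.
Local Open Scope ring_scope.

Let pi_ (v : 'cV[int]_n) : coker M :=
  \pi_(Quotient.quot (mximage M : zmodClosed 'cV[int]_n)) v.

Lemma coker_eq v w : pi_ v = pi_ w <-> exists x, v - w = M *m x.
Proof.
split=> [/eqP|[x vwx]]; last first.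
  by apply/eqP; rewrite /pi_ -Quotient.idealrBE; apply/asboolP; exists x.
by rewrite /pi_ -Quotient.idealrBE => /asboolP.
Qed.

Lemma coker_mulrn v k : pi_ v *+ k = pi_ (v *+ k).
Proof. by rewrite /pi_ raddfMn. Qed.

(** Q only changes the preimage, so P carries the image of M onto that of the diagonal matrix, where
    membership is coordinatewise divisibility. *)
Lemma smith_coordinates : exists2 P : 'M[int]_n, P \in unitmx &
  forall v w, pi_ v = pi_ w <-> forall j, (d ord0 j %| (P *m (v - w)) j ord0)%Z.
Proof.
have [_ [P [Q [uP uQ dE]]]] := d_smith; exists P => // v w; rewrite coker_eq; split.
  move=> [x ->] j.
  have -> : P *m (M *m x) = diag_mx d *m (invmx Q *m x).
    by rewrite -dE !mulmxA mulmxK.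
  by rewrite mul_diag_mx !mxE dvdz_mulr.
move=> dvd; pose y : 'cV[int]_n := \col_j ((P *m (v - w)) j ord0 %/ d ord0 j)%Z.
exists (Q *m y); apply: (can_inj (mulKmx uP)).
rewrite [RHS]mulmxA [RHS]mulmxA dE; apply/matrixP => i j.
by rewrite mul_diag_mx [in RHS]mxE [y i j]mxE (ord1 j) mulrC divzK.
Qed.

(** In the coordinates given by P, a class is torsion iff its coordinates over zero diagonal entries
    vanish; the remaining coordinates are residues modulo the nonzero entries. *)
Lemma card_coker_torsion :
  #|` fset_set (coker_torsion M)|%fset = (\prod_(j | d ord0 j != 0%R) `|d ord0 j|)%N.
Proof.
have [P uP piE] := smith_coordinates.
have pi0 : pi_ 0 = 0 by rewrite /pi_ raddf0.
(* The successor form makes every factor an inhabited ordinal type, with 0 as its only element where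
   the diagonal entry is zero. *)
have [m mE] : exists m : 'I_n -> nat,
    forall j, (m j).+1 = if d ord0 j == 0 then 1%N else `|d ord0 j|%N.
  exists (fun j => (if d ord0 j == 0 then 1%N else `|d ord0 j|%N).-1) => j.
  by case: eqVneq => // d0; rewrite prednK // absz_gt0.
pose G : finType := {dffun forall j : 'I_n, 'I_(m j).+1}.
pose vec (f : G) : 'cV[int]_n := invmx P *m \col_j (f j : nat)%:Z.
have Pvec f : P *m vec f = \col_j (f j : nat)%:Z by rewrite mulKVmx.
have f_lt (f : G) j : if d ord0 j == 0 then (f j : nat) = 0%N else (f j < `|d ord0 j|)%N.
  have := ltn_ord (f j); move: (nat_of_ord (f j)) => k; rewrite mE.
  by case: eqP => // _; rewrite ltnS leqn0 => /eqP.
have phi_inj : injective (fun f => pi_ (vec f)).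
  move=> f g /piE; rewrite mulmxBr !Pvec => dvd; apply/ffunP => j; apply/val_inj => /=.
  have := dvd j; rewrite !mxE; have := f_lt f j; have := f_lt g j.
  case: eqP => [_ -> -> //|_ lt_g lt_f]; rewrite dvdzE => dvd_fg.
  have [->//|fg] := eqVneq (f j : nat) (g j).
  have /dvdn_leq := dvd_fg; lia.
(* Presenting the torsion as a finite image also proves it finite, without which [fset_set] would be
   empty. *)
have -> : coker_torsion M = [set` [fset pi_ (vec f) | f in G]%fset]%classic.
  apply/seteqP; split=> t /=.
    move=> [k k_gt0]; rewrite -[t]reprK; set v := repr t => tk0.
    have dvd_kx j : (d ord0 j %| (P *m v) j ord0 *+ k)%Z.
      have /piE/(_ j) : pi_ (v *+ k) = pi_ 0 by rewrite -coker_mulrn pi0; exact: tk0.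
      by rewrite subr0 -scaler_nat -scalemxAr scaler_nat mulmxnE.
    pose f : G := [ffun j => inord `|((P *m v) j ord0 %% d ord0 j)%Z|%N].
    apply/imfsetP; exists f => //=; apply/piE => j.
    rewrite mulmxBr Pvec [X in (_ %| X)%Z]mxE [X in _ + X]mxE [X in - X]mxE ffunE.
    have := dvd_kx j; move: ((P *m v) j ord0) => x; rewrite -mulr_natr => dvd_kx'.
    have [d0|d0] := eqVneq (d ord0 j) 0.
      move: dvd_kx'; rewrite d0 !dvd0z mulf_eq0 Num.Theory.pnatr_eq0 eqn0Ngt k_gt0 orbF.
      by move=> /eqP->; rewrite inordK ?mod0z ?subrr.
    rewrite inordK ?mE ?(negPf d0); last by rewrite -ltz_nat gez0_abs ?modz_ge0 // ltz_mod.
    by rewrite gez0_abs ?modz_ge0 // -eqz_mod_dvd modz_mod.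
  move=> /imfsetP[f _ ->] /=.
  exists (\prod_(j | d ord0 j != 0) `|d ord0 j|)%N.
    by rewrite prodn_cond_gt0 // => j d0; rewrite absz_gt0.
  rewrite coker_mulrn -pi0.
  apply/piE => j; rewrite subr0 -scaler_nat -scalemxAr Pvec !mxE.
  have := f_lt f j; case: eqP => [-> ->|/eqP d0 _]; first by rewrite mulr0.
  by rewrite dvdz_mulr // (bigD1 j) //= natz dvdzE /= dvdn_mulr.
rewrite set_fsetK card_imfset //=.
have := card_dep_ffun (fun j => 'I_(m j).+1).
rewrite -cardE => ->; rewrite foldrE big_image [RHS]big_mkcond /=.
by apply: eq_bigr => j _; rewrite card_ord mE; case: eqP.
Qed.

Lemma coker_torsion_coprime l : prime l ->
  (forall j, d ord0 j != 0 -> ~~ (l %| `|d ord0 j|)%N) ->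
  ~~ (l %| #|` fset_set (coker_torsion M)|%fset)%N.
Proof.
move=> l_prime dl; rewrite card_coker_torsion -prime_coprime //.
apply: (big_ind (fun m => coprime l m)) => [|x y lx ly|j d0]; first exact: coprimen1.
  by rewrite coprimeMr lx.
by rewrite prime_coprime // dl.
Qed.

End CokernelTorsion.

(** * Arithmetic of the parameters *)

(** The number of lines equals h + (1 + (1 + g)) only propositionally; that equation is substituted
    here once for all cases. *)
Lemma incidence_eldiv_mult (l h g b : nat) (N : 'M[int]_(1 + (1 + h), b)) (L : 'M[int]_b)
    (a D s : int) (d : 'rV[int]_b) (r := (s + a - 1)%R) (u := (a - D)%R) (lam := (u * D - r)%R) :
  prime l -> b = h + (1 + (1 + g)) -> skew_incidence l N L a D s -> smith_diagonal L d ->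
  [/\ ~~ (l %| s)%Z -> forall i,
        eldiv_mult d l i =
        h * valuation_eq l r i + valuation_eq l (gcdz r u) i + g * (i == 0),
      forall e s' : int, ~~ (l %| r)%Z -> ~~ (l %| e)%Z -> (e * lam = s * s')%R -> forall i,
        eldiv_mult d l i = h.+1 * (i == 0) + g * valuation_eq l s i,
      forall e s' : int,
        ~~ (l %| r)%Z -> ~~ (l %| e)%Z -> (l %| a)%Z -> (l %| s)%Z -> (e * s = lam * s')%R ->
        forall i, eldiv_mult d l i =
        h.+1 * (i == 0) + valuation_eq l lam i + (g - 1) * valuation_eq l s i &
      ~~ (l %| u)%Z -> ~~ (l %| a)%Z -> (l %| (a - 1)%R)%Z -> (l %| D)%Z -> (a * lam = - u * s)%R ->
        forall i, eldiv_mult d l i =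
        h * valuation_eq l (r * s)%R i + h.+1 * (i == 0) + (g - h) * valuation_eq l s i].
Proof.
move=> l_prime b_hg skN d_smith; subst b; split.
- by move=> s_unit i; exact: (eldiv_mult_unit_s l_prime skN d_smith).
- move=> e s' r_unit e_unit e_lam i.
  exact: (eldiv_mult_unit_r_absorb l_prime skN d_smith i r_unit e_unit e_lam).
- move=> e s' r_unit e_unit l_a l_s e_s i.
  exact: (eldiv_mult_unit_r_primitive l_prime skN d_smith i r_unit e_unit l_a l_s e_s).
move=> u_unit a_unit l_a1 l_D a_lam i.
exact: (eldiv_mult_ramified l_prime skN d_smith i u_unit a_unit l_a1 l_D a_lam).
Qed.

(** The quotients by q + 1 are integers because they are differences: r = b - P, s = r + 1 - a, mu =
    s - q k. *)
Lemma skew_arithmetic q k b (D := q + 1) (a := k + q + 2) (P := 1 + q * a) :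
  b * D = P * a ->
  exists r s mu, [/\ b = P + r, D * r = k.+1 * P, D * s = q * a * k, r + 1 = s + a &
    D * mu = q * k.+1 * k].
Proof.
move=> bD; have D_gt0 : 0 < D by rewrite /D addn1.
have aD : a = k.+1 + D by rewrite /a /D; lia.
have Pb : P <= b by rewrite -(leq_pmul2r D_gt0) bD leq_mul2l aD leq_addl orbT.
have Dr : D * (b - P) = k.+1 * P.
  by rewrite mulnBr mulnC bD (mulnC D) -mulnBr aD addnK mulnC.
have Dr1 : D * (b - P + 1) = D * a + q * a * k.
  by rewrite mulnDr Dr muln1 /P /D /a; ring.
have ar : a <= b - P + 1 by rewrite -(leq_pmul2l D_gt0) Dr1 leq_addr.
have Ds : D * (b - P + 1 - a) = q * a * k by rewrite mulnBr Dr1 addKn.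
exists (b - P), (b - P + 1 - a), (b - P + 1 - a - q * k); split=> //.
- by rewrite subnKC.
- by rewrite subnK.
rewrite mulnBr Ds (_ : q * a * k = q * k.+1 * k + D * (q * k)) ?addnK //.
by rewrite aD; ring.
Qed.

(** Here k is [n-1] - (q + 2), not the valency, and k + 1 is the u of the block form. The
    multiplicity g equals the eigenvalue r because D (b - P) = P (a - D) = D r, with D = q + 1. *)
Record skew_numbers (q n b k a P r s mu g : nat) : Prop := SkewNumbers {
  skew_q : 1 < q;
  skew_k : q ^ 2 * qint q (n - 3) = k.+1;
  skew_k_gt0 : 0 < k;
  skew_a : a = k + q + 2;
  skew_aE : qint q (n - 1) = a;
  skew_P : P = 1 + q * a;
  skew_PE : qint q n = P;
  skew_r : (q + 1) * r = k.+1 * P;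
  skew_s : (q + 1) * s = q * a * k;
  skew_mu : (q + 1) * mu = q * k.+1 * k;
  skew_rs : r + 1 = s + a;
  skew_b : b = P + g;
  skew_g : g = r }.

Lemma exists_skew_numbers (F : finFieldType) (V : vectType F) (q := #|F|) (n := \dim {:V})
    (a := qint q (n - 1)) (P := qint q n) (k := a - (q + 2)) :
  4 <= n ->
  skew_numbers q n #|line V| k a P ((q ^ 2 * qint q (n - 3) * P) %/ (q + 1))
    ((q * a * k) %/ (q + 1)) ((q ^ 3 * qint q (n - 3) * k) %/ (q + 1)) (qbinom F n 2 - P).
Proof.
move=> n_ge4; have q_gt1 : 1 < q := card_finNzRing_gt1 F.
have nE m : m < n -> qint q (n - m) = 1 + q * qint q (n - m.+1).
  by move=> mn; rewrite -qintS // subnSK.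
have x_gt0 : 0 < qint q (n - 3) by rewrite (nE 3).
have aE : a = q + 1 + q ^ 2 * qint q (n - 3).
  by rewrite /a (nE 1) ?(nE 2) ?expnS ?expn0; [ring | lia..].
have q2 : 2 <= q ^ 2 * qint q (n - 3).
  rewrite (leq_trans _ (leq_pmulr _ x_gt0)) // (leq_trans q_gt1) //.
  by rewrite expnS expn1 leq_pmulr // ltnW.
have ak : a = k + q + 2 by rewrite /k aE; move: q2; set y := q ^ 2 * _; lia.
have q2x : q ^ 2 * qint q (n - 3) = k.+1.
  by move: ak; rewrite aE; set y := q ^ 2 * _; lia.
have PE : P = 1 + q * (k + q + 2) by rewrite -ak /P /a -(nE 0) ?subn0 //; lia.
have D_gt0 : 0 < q + 1 by rewrite addn1.
have bD : #|line V| * (q + 1) = (1 + q * (k + q + 2)) * (k + q + 2).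
  by rewrite card_lineE -/q -/n -/a -/P PE ak.
have bq : #|line V| = qbinom F n 2.
  by apply/eqP; rewrite -(eqn_pmul2r D_gt0) card_lineE qbinom2E.
have [r [s [mu [bE rE sE rs muE]]]] := skew_arithmetic bD.
have -> : q ^ 2 * qint q (n - 3) * P %/ (q + 1) = r by rewrite q2x PE -rE mulKn.
have -> : q * a * k %/ (q + 1) = s by rewrite ak -sE mulKn.
have -> : q ^ 3 * qint q (n - 3) * k %/ (q + 1) = mu.
  by rewrite expnS -(mulnA q) q2x -muE mulKn.
move: bE rE sE rs muE; rewrite -!ak bq => bE rE sE rs muE.
by split; rewrite // ?PE -?ak // ?bq ?bE ?addKn // -ltnS -q2x.
Qed.

Lemma valuation_eq_nat l c i : 0 < c -> valuation_eq l (c : int) i = (logn l c == i).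
Proof. by rewrite /valuation_eq; case: c. Qed.

(** The relations P lam = - r q k and D s = q a k compare lam, s and k up to units. With D mu = q (k
    + 1) k and D r = (k + 1) P they also show lam = -mu. *)
Lemma skew_eldiv_mult (F : finFieldType) (V : vectType F) (l k a P r s mu g h : nat)
    (d : 'rV[int]_#|line V|) (q := #|F|) (n := \dim {:V}) (e := eldiv_mult d l) :
  prime l -> ~~ (l %| q) -> 4 <= n -> smith_diagonal (skew_laplacian V) d ->
  skew_numbers q n #|line V| k a P r s mu g -> P = h.+2 ->
  [/\ ~~ (l %| s) ->
        forall i, e i = h * (logn l r == i) + (logn l (gcdn r k.+1) == i) + g * (i == 0),
      ~~ (l %| q + 1) -> ~~ (l %| r) -> ~~ (l %| a) ->
        forall i, e i = h.+1 * (i == 0) + g * (logn l s == i),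
      ~~ (l %| q + 1) || ~~ (l %| k) -> ~~ (l %| r) -> l %| a -> l %| s ->
        forall i, e i = h.+1 * (i == 0) + (logn l k == i) + (g - 1) * (logn l s == i) &
      l %| q + 1 -> ~~ (l %| k.+1) -> ~~ (l %| a) -> l %| P ->
        forall i, e i = h * (logn l (r * s) == i) + h.+1 * (i == 0) + (g - h) * (logn l s == i)].
Proof.
move=> l_prime l_q n_ge4 d_smith [q_gt1 q2x k_gt0 aE qa PE qP rE sE muE rsE bE gE] P_h.
have skN := @skew_incidenceP F V l h l_prime l_q (ltnW n_ge4) (etrans qP P_h).
have lines := incidence_lines skN; have flags := incidence_flags skN.
rewrite -/q -/n qa in skN lines flags.
set s0 := ((skew_valency V)%:R - q%:R)%R in skN lines flags.
have D_neq0 : (q%:R + 1 != 0 :> int)%R by rewrite natr1 Num.Theory.pnatr_eq0.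
have a_int : (a%:R = k%:R + q%:R + 2 :> int)%R by rewrite aE !natrD.
have P_int : (P%:R = 1 + q%:R * a%:R :> int)%R by rewrite PE natrD natrM.
have r_int : ((q%:R + 1) * r%:R = (k%:R + 1) * P%:R :> int)%R.
  by rewrite natr1 [in RHS]natr1 -!natrM -rE addn1.
have s_int : ((q%:R + 1) * s%:R = q%:R * a%:R * k%:R :> int)%R.
  by rewrite natr1 -!natrM -sE addn1.
have rs_int : (r%:R = s%:R + a%:R - 1 :> int)%R by rewrite -natrD -rsE natrD addrK.
have s0E : s0 = s%:R%R.
  apply: (mulfI D_neq0); rewrite s_int.
  have -> : s0 = (#|line V|%:R - a%:R * (q%:R + 1))%R.
    by move: lines; rewrite natrD -natz => ->; rewrite addrK.
  rewrite mulrBr; move: flags; rewrite -P_h -!natz natrD => ->.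
  by rewrite P_int a_int; ring.
rewrite s0E in skN.
have b_hg : #|line V| = h + (1 + (1 + g)) by rewrite bE P_h; lia.
have [E1 E2 E3 E4] := incidence_eldiv_mult l_prime b_hg skN d_smith.
have a_gt0 : 0 < a by rewrite aE addn2.
have P_gt0 : 0 < P by rewrite P_h.
have r_gt0 : 0 < r.
  case: (r) rE => //; rewrite muln0 => /esym/eqP; rewrite muln_eq0 /= => /eqP P0.
  by rewrite P0 in P_gt0.
have s_gt0 : 0 < s.
  case: (s) sE => //; rewrite muln0 => /esym/eqP; rewrite !muln_eq0.
  by rewrite !eqn0Ngt a_gt0 k_gt0 (ltnW q_gt1).
have u_int : (a%:R - (q + 1)%:R = k.+1%:R :> int)%R.
  by rewrite a_int natrD -natr1; ring.
move: E1 E2 E3 E4; rewrite -rs_int u_int natrD !natz.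
set lam := (k.+1%:Z * (q%:Z + 1%:Z) - r%:Z)%R.
move=> E1 E2 E3 E4.
move: a_int P_int r_int s_int; rewrite !natz => a_int P_int r_int s_int.
(* From D r = u P one gets P lam = r (D^2 - P), and P = D^2 + q k. *)
have P_lam : (P%:Z * lam = - (r%:Z * q%:Z * k%:Z))%R.
  rewrite (_ : _ * lam = (q%:Z + 1) * ((k%:Z + 1) * P%:Z) - P%:Z * r%:Z)%R; last first.
    by rewrite /lam -addn1 PoszD; ring.
  by rewrite -r_int P_int a_int; ring.
have unitM x y : ~~ (l %| x) -> ~~ (l %| y) -> ~~ (l %| x * y).
  by move=> lx ly; rewrite Euclid_dvdM // negb_or lx.
have nP : ~~ (l %| q + 1) -> ~~ (l %| r) -> ~~ (l %| P).
  by move=> lD lr; have := unitM _ _ lD lr; rewrite rE Euclid_dvdM // negb_or => /andP[].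
have logn0 m : ~~ (l %| m) -> logn l m = 0 by move=> lm; apply/eqP; rewrite lognE (negPf lm) !andbF.
have vlam : ~~ (l %| P) -> ~~ (l %| r) -> forall i, valuation_eq l lam i = (logn l k == i).
  move=> lP lr i; have Plam : P * `|lam|%N = r * q * k.
    by have := congr1 absz P_lam; rewrite abszN !abszM !absz_nat.
  have lam_gt0 : 0 < `|lam|%N.
    by rewrite -(ltn_pmul2l P_gt0) muln0 Plam !muln_gt0 r_gt0 k_gt0 (ltnW q_gt1).
  rewrite /valuation_eq -absz_gt0 lam_gt0 /=; congr (_ == i).
  rewrite -[LHS]add0n -(logn0 P lP) -lognM // Plam !lognM ?muln_gt0 ?r_gt0 ?(ltnW q_gt1) //.
  by rewrite (logn0 _ lr) (logn0 _ l_q).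
split.
- move=> s_unit i; rewrite /e E1 // !valuation_eq_nat //.
  by rewrite gcdn_gt0 r_gt0.
(* The witnesses express (a P) lam = - s (r D), where a P is a unit. *)
- move=> D_unit r_unit a_unit i; rewrite /e (E2 (a%:Z * P%:Z)%R (- (r%:Z * (q%:Z + 1)))%R) //.
  + by rewrite valuation_eq_nat.
  + by rewrite -PoszM; exact: unitM (nP D_unit r_unit).
  rewrite -mulrA P_lam (_ : s%:Z * _ = - (r%:Z * ((q%:Z + 1) * s%:Z)))%R; last by ring.
  by rewrite s_int; ring.
- move=> Dk r_unit l_a l_s i.
  have P_unit : ~~ (l %| P) by rewrite PE dvdn_addl ?dvdn1 ?dvdn_mull // neq_ltn prime_gt1 ?orbT.
  (* If l does not divide k, lam is itself a unit; if l does not divide q + 1, then D r is a unit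
     and D r s = - lam a P. *)
  have [[e0 s'] /= e0_unit e0_s] :
      exists2 es : int * int, ~~ (l %| es.1)%Z & (es.1 * s%:Z = lam * es.2)%R.
    case/orP: Dk => [D_unit|k_unit]; last first.
      exists (lam, (s : int)) => //=; have : ~~ (l %| (P%:Z * lam)%R)%Z.
        rewrite P_lam dvdzE abszN !abszM !absz_nat.
        by exact: (unitM _ _ (unitM _ _ r_unit l_q) k_unit).
      by apply: contra => /dvdz_mull; apply.
    exists (((q%:Z + 1) * r%:Z)%R, (- (a%:Z * P%:Z))%R) => /=.
      by rewrite dvdzE abszM; apply: unitM.
    rewrite (_ : lam * _ = - (a%:Z * (P%:Z * lam)))%R; last by ring.
    by rewrite P_lam mulrAC s_int; ring.
  by rewrite /e (E3 e0 s') // vlam // valuation_eq_nat.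
move=> l_D k1_unit a_unit l_P i; rewrite /e E4 //.
- by rewrite -PoszM !valuation_eq_nat // muln_gt0 r_gt0.
- rewrite (_ : a%:Z - 1 = a%:Z * (q%:Z + 1) - P%:Z)%R; last by rewrite P_int; ring.
  by rewrite rpredB // dvdz_mull.
(* The identity a lam = - u s is verified after multiplication by D P, which is nonzero. *)
apply: (mulfI (x := (q%:Z + 1)%R)); first by move: D_neq0; rewrite natz.
apply: (mulfI (x := (P : int))); first by rewrite -lt0n in P_gt0 *.
rewrite (_ : P%:Z * _ = (q%:Z + 1) * a%:Z * (P%:Z * lam))%R; last by ring.
rewrite P_lam (_ : P%:Z * _ = - (k.+1%:Z * P%:Z * ((q%:Z + 1) * s%:Z)))%R; last by ring.
rewrite s_int -addn1 PoszD -r_int; ring.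
Qed.

Lemma exactly2 (e : nat -> nat) a A B : 0 < a ->
  (forall i, e i = A * (a == i) + B * (i == 0)) -> exactly e [:: (a, A); (0, B)].
Proof.
move=> a_gt0 eE; split=> [i m|i]; rewrite !inE eE.
  case/orP=> /eqP[-> ->]; first by rewrite eqxx (gtn_eqF a_gt0) muln1 muln0 addn0.
  by rewrite (gtn_eqF a_gt0) muln0 muln1.
by rewrite negb_or => /andP[/negPf + /negPf->]; rewrite eq_sym => ->; rewrite !muln0.
Qed.

Lemma exactly3 (e : nat -> nat) a b A B C : 0 < b < a ->
  (forall i, e i = A * (a == i) + B * (b == i) + C * (i == 0)) ->
  exactly e [:: (a, A); (b, B); (0, C)].
Proof.
move=> /andP[b_gt0 ba] eE; have a_gt0 := ltn_trans b_gt0 ba.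
split=> [i m|i]; rewrite !inE eE.
  case/or3P=> /eqP[-> ->].
  - by rewrite eqxx (ltn_eqF ba) (gtn_eqF a_gt0) !muln0 !addn0 muln1.
  - by rewrite eqxx (gtn_eqF ba) (gtn_eqF b_gt0) !muln0 !addn0 muln1.
  by rewrite (gtn_eqF a_gt0) (gtn_eqF b_gt0) !muln0 muln1.
rewrite !negb_or => /and3P[/negPf + /negPf + /negPf->].
by rewrite ![i == _]eq_sym => -> ->; rewrite !muln0.
Qed.

Lemma smith_critical_order (F : finFieldType) (V : vectType F) (l : nat)
    (d : 'rV[int]_#|line V|) :
  prime l -> smith_diagonal (skew_laplacian V) d ->
  (forall i, 0 < i -> eldiv_mult d l i = 0) -> ~~ (l %| critical_order V).
Proof.
move=> l_prime d_smith e0; apply: (coker_torsion_coprime d_smith) => // j dj.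
apply/negP => l_d.
have /e0/card0_eq/(_ j) : 0 < logn l `|d ord0 j|%N.
  by rewrite logn_gt0 mem_primes l_prime l_d absz_gt0 dj.
by rewrite !inE dj eqxx.
Qed.

Lemma qint_even q m : 1 < q -> (q + 1 %| qint q (2 * m)).
Proof.
move=> q_gt1; elim: m => [|m IHm]; first by rewrite qint0 dvdn0.
rewrite mulnS !qintS // (_ : 1 + _ = q + 1 + q * q * qint q (2 * m)); last by ring.
by rewrite dvdn_add // dvdn_mull.
Qed.

(** The quotient is 1 + q^2 + ... + q^(2m-2), and q^2 = 1 mod l because q = -1. This is how (n -
    1)/2 enters for odd n. *)
Lemma qint_even_modn l q m : 1 < q -> l %| q + 1 -> qint q (2 * m) %/ (q + 1) = m %[mod l].
Proof.
move=> q_gt1 l_q1; elim: m => [|m IHm]; first by rewrite qint0 div0n.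
rewrite mulnS !qintS // (_ : 1 + _ = 1 * (q + 1) + q ^ 2 * qint q (2 * m)); last first.
  by rewrite expnS expn1; ring.
rewrite divnMDl ?addn1 // -[q.+1]addn1 -muln_divA ?qint_even //; set Y := qint _ _ %/ _ in IHm *.
have [c qc] := dvdnP l_q1; have {}qc : q ^ 2 = (q - 1) * c * l + 1.
  by rewrite -mulnA -qc -[in LHS](subnK (ltnW q_gt1)) -[in q + 1](subnK (ltnW q_gt1)); ring.
rewrite qc (_ : 1 + _ = (q - 1) * c * Y * l + (Y + 1)); last first.
  by move: (q - 1) => z; ring.
by rewrite modnMDl -modnDml IHm modnDml addn1.
Qed.

Lemma dvdn_logn_gt0 l m : prime l -> 0 < m -> (l %| m) = (0 < logn l m).
Proof. by move=> l_prime m_gt0; rewrite logn_gt0 mem_primes l_prime m_gt0. Qed.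

(** * Valuations of the parameters, case by case *)

Section Cases.
Variables (l q n b k a P r s mu g h : nat) (e : nat -> nat).
Hypothesis l_prime : prime l.
Hypothesis l_q : ~~ (l %| q).
Hypothesis n_gt0 : 0 < n.
Hypothesis num : skew_numbers q n b k a P r s mu g.
Hypothesis P_h : P = h.+2.
Hypothesis unit_s : ~~ (l %| s) ->
  forall i, e i = h * (logn l r == i) + (logn l (gcdn r k.+1) == i) + g * (i == 0).
Hypothesis unit_r : ~~ (l %| q + 1) -> ~~ (l %| r) -> ~~ (l %| a) ->
  forall i, e i = h.+1 * (i == 0) + g * (logn l s == i).
Hypothesis unit_r_dvd_a : ~~ (l %| q + 1) || ~~ (l %| k) -> ~~ (l %| r) -> l %| a -> l %| s ->
  forall i, e i = h.+1 * (i == 0) + (logn l k == i) + (g - 1) * (logn l s == i).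
Hypothesis ramified : l %| q + 1 -> ~~ (l %| k.+1) -> ~~ (l %| a) -> l %| P ->
  forall i, e i = h * (logn l (r * s) == i) + h.+1 * (i == 0) + (g - h) * (logn l s == i).

Let f := P - 1.

Lemma skew_positive : [/\ 0 < a, 0 < P, 0 < r, 0 < s & 0 < g].
Proof.
have a_gt0 : 0 < a by rewrite (skew_a num) addn2.
have P_gt0 : 0 < P by rewrite P_h.
have r_gt0 : 0 < r.
  case: (posnP r) (skew_r num) => // ->; rewrite muln0 => /esym/eqP.
  by rewrite muln_eq0 (gtn_eqF P_gt0).
have s_gt0 : 0 < s.
  case: (posnP s) (skew_s num) => // ->; rewrite muln0 => /esym/eqP.
  by rewrite !muln_eq0 !eqn0Ngt a_gt0 (skew_k_gt0 num) (ltnW (skew_q num)).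
by split=> //; rewrite (skew_g num).
Qed.

Let logn_unit m : ~~ (l %| m) -> logn l m = 0.
Proof. by move=> lm; apply/eqP; rewrite lognE (negPf lm) !andbF. Qed.

Let f_h : f = h.+1. Proof. by rewrite /f P_h subn1. Qed.

Let unitM x y : ~~ (l %| x * y) = ~~ (l %| x) && ~~ (l %| y).
Proof. by rewrite Euclid_dvdM // negb_or. Qed.

Let k1_x : logn l k.+1 = logn l (qint q (n - 3)).
Proof.
have x_gt0 : 0 < qint q (n - 3).
  by case: (posnP (qint q (n - 3))) (skew_k num) => // ->; rewrite muln0.
rewrite -(skew_k num) lognM ?expn_gt0 ?(ltnW (skew_q num)) // lognX.
by rewrite (logn_unit l_q) muln0.
Qed.

Lemma unit_rs : ~~ (l %| r) -> ~~ (l %| s) -> forall i, 0 < i -> e i = 0.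
Proof.
move=> lr ls i i_gt0; rewrite unit_s // (logn_unit lr) logn_unit; last first.
  by apply: contra lr => /dvdn_trans; apply; apply: dvdn_gcdl.
by rewrite (gtn_eqF i_gt0) (ltn_eqF i_gt0) !muln0.
Qed.

Section TameCase.
Hypothesis l_D : ~~ (l %| q + 1).

(** As r + 1 = s + a, l would not divide a, so D s = q a k gives l | k. Then l does not divide k +
    1, and D r = (k + 1) P gives l | P. But P = (q + 1)^2 + q k, so l would divide q + 1. *)
Lemma tame_not_both : ~ (l %| r /\ l %| s).
Proof.
move=> [lr ls].
have la : ~~ (l %| a).
  apply/negP => la; have : l %| r + 1 by rewrite (skew_rs num) dvdn_add.
  by rewrite dvdn_addr // dvdn1 => /eqP l1; move: l_prime; rewrite l1.
have lk : l %| k.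
  have : l %| (q + 1) * s by rewrite dvdn_mull.
  by rewrite (skew_s num) !Euclid_dvdM // (negPf l_q) (negPf la).
have lP : l %| P.
  have : l %| (q + 1) * r by rewrite dvdn_mull.
  rewrite (skew_r num) Euclid_dvdM // => /orP[|//].
  by rewrite -addn1 dvdn_addr // dvdn1 => /eqP l1; move: l_prime; rewrite l1.
have : l %| (q + 1) * (q + 1) + q * k.
  by rewrite (_ : _ + _ = P) // (skew_P num) (skew_a num); ring.
rewrite dvdn_addl; last by rewrite dvdn_mull.
by rewrite Euclid_dvdM // (negPf l_D).
Qed.

Let logn_r : logn l r = logn l k.+1 + logn l P.
Proof.
have [_ P_gt0 r_gt0 _ _] := skew_positive.
rewrite -lognM // -(skew_r num) lognM ?addn1 //.
by rewrite -[q.+1]addn1 (logn_unit l_D).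
Qed.

Let logn_gcd : logn l (gcdn r k.+1) = logn l k.+1.
Proof.
have [_ _ r_gt0 _ _] := skew_positive.
by rewrite logn_gcd // logn_r; apply/minn_idPr; rewrite leq_addr.
Qed.

(** There are f - 1 entries r, of valuation v([n]) + v([n-3]), and one entry gcd(r, u), of valuation
    v([n-3]). The latter joins the units if l does not divide [n-3], and the entries r if l does not
    divide [n]. *)
Lemma tame_dvd_r : l %| r -> ~~ (l %| s) ->
  [/\ l %| P -> ~~ (l %| qint q (n - 3)) -> exactly e [:: (logn l P, f - 1); (0, g + 1)],
      l %| P -> l %| qint q (n - 3) ->
        exactly e [:: (logn l P + logn l (qint q (n - 3)), f - 1);
                      (logn l (qint q (n - 3)), 1); (0, g)]
    & ~~ (l %| P) -> l %| qint q (n - 3) -> exactly e [:: (logn l (qint q (n - 3)), f); (0, g)]].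
Proof.
move=> lr ls; have eE := unit_s ls; have [_ P_gt0 _ _ _] := skew_positive.
have x_gt0 : 0 < qint q (n - 3).
  by case: (posnP (qint q (n - 3))) (skew_k num) => // ->; rewrite muln0.
rewrite logn_gcd logn_r k1_x in eE; rewrite f_h subn1 /=; split=> lP lx.
- apply: exactly2; first by rewrite -dvdn_logn_gt0.
  by move=> i; rewrite eE (logn_unit lx) add0n mulnDl mul1n [0 == i]eq_sym addnAC addnA.
- apply: exactly3.
    by rewrite -dvdn_logn_gt0 // lx -[X in X < _]add0n ltn_add2r -dvdn_logn_gt0.
  by move=> i; rewrite eE mul1n addnC [_ + logn l P]addnC addnC.
apply: exactly2; first by rewrite -dvdn_logn_gt0.
by move=> i; rewrite eE (logn_unit lP) addn0 mulSn [X in X + _ = _]addnC.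
Qed.

(** When l divides [n-1], one of the g entries s gives way to lam, whose valuation is v(k) = v(mu).
    If this is 0, the entry joins the units. *)
Lemma tame_dvd_s : l %| s -> ~~ (l %| r) ->
  (~~ (l %| a) -> exactly e [:: (logn l s, g); (0, f)]) /\
  (l %| a ->
    [/\ logn l s = logn l a + logn l mu,
        logn l mu = 0 -> exactly e [:: (logn l a, g - 1); (0, f + 1)]
      & 0 < logn l mu ->
        exactly e [:: (logn l a + logn l mu, g - 1); (logn l mu, 1); (0, f)]]).
Proof.
move=> ls lr; have [a_gt0 P_gt0 r_gt0 s_gt0 g_gt0] := skew_positive; rewrite f_h; split=> la.
  apply: exactly2; first by rewrite -dvdn_logn_gt0.
  by move=> i; rewrite unit_r // addnC.
have k_gt0 := skew_k_gt0 num; have q_gt0 := ltnW (skew_q num).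
have mu_gt0 : 0 < mu.
  case: (posnP mu) (skew_mu num) => // ->; rewrite muln0 => /esym/eqP.
  by rewrite !muln_eq0 !eqn0Ngt k_gt0 q_gt0.
have k1_unit : ~~ (l %| k.+1).
  have : ~~ (l %| (q + 1) * r) by rewrite unitM l_D.
  by rewrite (skew_r num) unitM => /andP[].
have mu_k : logn l mu = logn l k.
  have := congr1 (logn l) (skew_mu num).
  rewrite !lognM ?muln_gt0 ?q_gt0 ?addn_gt0 ?orbT //.
  by rewrite (logn_unit l_D) (logn_unit l_q) (logn_unit k1_unit).
have s_ak : logn l s = logn l a + logn l mu.
  have := congr1 (logn l) (skew_s num).
  rewrite mu_k !lognM ?muln_gt0 ?q_gt0 ?addn_gt0 ?orbT //.
  by rewrite (logn_unit l_D) (logn_unit l_q).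
have eE := unit_r_dvd_a (introT orP (or_introl l_D)) lr la ls.
rewrite -mu_k s_ak in eE; split=> // [mu0|mu_gt0'].
  apply: exactly2; first by rewrite -dvdn_logn_gt0.
  by move=> i; rewrite eE mu0 addn0 [0 == i]eq_sym [RHS]addnC [(_ + 1) * _]mulnDl mul1n.
apply: exactly3; first by rewrite mu_gt0' -[X in X < _]add0n ltn_add2r -dvdn_logn_gt0.
by move=> i; rewrite eE mul1n addnC addnCA addnC addnAC.
Qed.

End TameCase.
Section RamifiedCase.
Hypothesis l_D : l %| q + 1.

Let prime_dvd1 : ~~ (l %| 1). Proof. by rewrite dvdn1 neq_ltn prime_gt1 ?orbT. Qed.

(** For even n, q + 1 divides P while a and k + 1 are units. Up to units r is P' = P / (q + 1) and s
    is k' = P' - (q + 1), and these are congruent mod l. *)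
Lemma ramified_even : ~~ odd n ->
  (0 < logn l r <-> 0 < logn l s) /\
  (0 < logn l r -> 0 < logn l s ->
    exactly e [:: (logn l r + logn l s, f - 1); (logn l s, g - f + 1); (0, f)]).
Proof.
move=> n_even; have [a_gt0 P_gt0 r_gt0 s_gt0 g_gt0] := skew_positive.
have D_gt0 : 0 < q + 1 by rewrite addn1.
have aE : a = k.+1 + (q + 1) by rewrite (skew_a num); ring.
have [P' PP'] : exists P', P = P' * (q + 1).
  apply/dvdnP; rewrite -(skew_PE num) -[n]odd_double_half (negPf n_even) -mul2n.
  exact: qint_even (skew_q num).
have l_P : l %| P by rewrite PP' dvdn_mull.
have l_a : ~~ (l %| a).
  by apply: contra prime_dvd1 => la; move: l_P; rewrite (skew_P num) dvdn_addl // dvdn_mull.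
have l_k1 : ~~ (l %| k.+1) by apply: contra l_a => lk; rewrite aE dvdn_add.
have rE : r = k.+1 * P'.
  by apply/eqP; rewrite -(eqn_pmul2l D_gt0) (skew_r num) PP'; apply/eqP; ring.
have DP' : (q + 1) * P' = (q + 1) * (q + 1) + q * k.
  by rewrite mulnC -PP' (skew_P num) (skew_a num); ring.
have [k' P'E] : exists k', P' = q + 1 + k'.
  by exists (P' - (q + 1)); rewrite subnKC // -(leq_pmul2l D_gt0) DP' leq_addr.
have qk : q * k = (q + 1) * k'.
  by apply/eqP; rewrite -(eqn_add2l ((q + 1) * (q + 1))) -DP' P'E mulnDr.
have sE : s = a * k'.
  apply/eqP; rewrite -(eqn_pmul2l D_gt0) (skew_s num) mulnAC qk; apply/eqP; ring.
have P'_gt0 : 0 < P' by rewrite P'E addn_gt0 D_gt0.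
have k'_gt0 : 0 < k' by move: s_gt0; rewrite sE muln_gt0 => /andP[].
have logn_r : logn l r = logn l P' by rewrite rE lognM // (logn_unit l_k1).
have logn_s : logn l s = logn l k' by rewrite sE lognM // (logn_unit l_a).
split; first by rewrite logn_r logn_s -!dvdn_logn_gt0 // P'E dvdn_addr.
move=> lr ls; have eE := ramified l_D l_k1 l_a l_P.
(* Since f = h + 1, this makes [g - h] equal to [g - f + 1] despite truncated subtraction. *)
have h_g : h < g.
  rewrite (skew_g num) -(leq_pmul2l D_gt0) (skew_r num) P_h.
  have : q + 1 <= k.+1.
    rewrite -(skew_k num) addn1 (leq_trans (_ : q.+1 <= q ^ 2)) //.
      rewrite expnS expn1 (leq_trans _ (leq_mul (skew_q num) (leqnn q))) //.
      by rewrite mul2n -addnn -addn1 leq_add2l ltnW ?(skew_q num).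
    by rewrite leq_pmulr //; case: (posnP (qint q (n - 3))) (skew_k num) => // ->; rewrite muln0.
  by move=> /leq_mul; apply; apply: leqW.
apply: exactly3; first by rewrite ls -[X in X < _]add0n ltn_add2r.
move=> i; rewrite eE lognM // f_h subn1 /= subnS addn1 prednK ?subn_gt0 //.
by rewrite addnAC.
Qed.

(** For odd n, q + 1 divides a; put a' = a / (q + 1) = c + 1. Then P and k are units, r = c P and s
    = q a' k, so r and s have the valuations of the consecutive integers c and a', and a' = (n -
    1)/2 mod l. *)
Lemma ramified_odd (m := (n - 1) %/ 2) : odd n -> ~ (forall i, 0 < i -> e i = 0) ->
  [/\ (0 < logn l r /\ logn l s = 0) \/ (logn l r = 0 /\ 0 < logn l s),
      ~~ (l %| m) ->
        (0 < logn l r -> logn l s = 0 -> exactly e [:: (logn l r, f); (0, g)]) /\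
        (logn l r = 0 -> 0 < logn l s -> exactly e [:: (logn l s, g); (0, f)])
    & l %| m ->
        [/\ 0 < logn l s, logn l r = 0 & exactly e [:: (logn l s, g - 1); (0, f + 1)]]].
Proof.
move=> n_odd crit; have [a_gt0 P_gt0 r_gt0 s_gt0 g_gt0] := skew_positive.
have D_gt0 : 0 < q + 1 by rewrite addn1.
have aE : a = k.+1 + (q + 1) by rewrite (skew_a num); ring.
have nE : n - 1 = 2 * m.
  by rewrite /m mulnC divnK // dvdn2 oddB // n_odd.
pose a' := a %/ (q + 1).
have aa' : a = a' * (q + 1).
  by rewrite divnK // -(skew_aE num) nE qint_even // (skew_q num).
have a'_m : (l %| a') = (l %| m).
  by rewrite /dvdn /a' -(skew_aE num) nE qint_even_modn // (skew_q num).
have [c a'E] : exists c, a' = c.+1.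
  by case: (a') aa' => [|c _]; [move=> a0; rewrite a0 in a_gt0 | exists c].
have k1E : k.+1 = c * (q + 1).
  by apply/eqP; rewrite -(eqn_add2r (q + 1)) -aE aa' a'E mulSn addnC.
have l_a : l %| a by rewrite aa' dvdn_mull.
have l_P : ~~ (l %| P).
  by apply: contra prime_dvd1; rewrite (skew_P num) dvdn_addl // dvdn_mull.
have l_k : ~~ (l %| k).
  apply: contra prime_dvd1 => lk; have : l %| k.+1 by rewrite k1E dvdn_mull.
  by rewrite -addn1 dvdn_addr.
have rE : r = c * P.
  by apply/eqP; rewrite -(eqn_pmul2l D_gt0) (skew_r num) k1E; apply/eqP; ring.
have sE : s = q * a' * k.
  by apply/eqP; rewrite -(eqn_pmul2l D_gt0) (skew_s num) aa'; apply/eqP; ring.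
have c_gt0 : 0 < c by move: r_gt0; rewrite rE muln_gt0 => /andP[].
have logn_r : logn l r = logn l c by rewrite rE lognM // (logn_unit l_P) addn0.
have a'_gt0 : 0 < a' by rewrite a'E.
have logn_s : logn l s = logn l a'.
  rewrite sE !lognM ?muln_gt0 ?(ltnW (skew_q num)) ?(skew_k_gt0 num) //.
  by rewrite (logn_unit l_q) (logn_unit l_k) addn0.
have dvd_r : (l %| r) = (l %| c) by rewrite !dvdn_logn_gt0 // logn_r.
have dvd_s : (l %| s) = (l %| a') by rewrite !dvdn_logn_gt0 // logn_s.
have not_both : l %| a' -> ~~ (l %| c).
  by move=> la; apply: contra prime_dvd1 => lc; move: la; rewrite a'E -addn1 dvdn_addr.
split.
- have [la|la] := boolP (l %| a').
    right; split; first by rewrite logn_unit // dvd_r not_both.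
    by rewrite -dvdn_logn_gt0 // dvd_s.
  left; split; last by rewrite logn_unit // dvd_s.
  rewrite -dvdn_logn_gt0 //; apply: contraT => lr; case: crit.
  by apply: unit_rs lr _; rewrite dvd_s.
(* Here l does not divide a', so v(s) = 0 and the second alternative is contradictory. *)
- move=> l_m; rewrite f_h; split=> [lr ls|_]; last first.
    by rewrite logn_s -dvdn_logn_gt0 // a'_m (negPf l_m).
  apply: exactly2 => // i; rewrite unit_s; last by rewrite dvd_s a'_m.
  (* As k + 1 = c (q + 1), v(k + 1) is at least v(r), so the gcd counts as one more entry r and
     their number becomes f. *)
  have -> : logn l (gcdn r k.+1) = logn l r.
    by rewrite logn_gcd //; apply/minn_idPl; rewrite logn_r k1E lognM // leq_addr.
  by rewrite mulSn [(_ == i) + _]addnC.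
move=> l_m; have l_s : l %| s by rewrite dvd_s a'_m.
have l_r : ~~ (l %| r) by rewrite dvd_r not_both // a'_m.
rewrite -dvdn_logn_gt0 // l_s logn_unit // f_h; split=> //.
(* As l does not divide k, the isolated entry is a unit and raises e_0 to f + 1. *)
apply: exactly2 => [|i]; first by rewrite -dvdn_logn_gt0.
rewrite unit_r_dvd_a ?l_k ?orbT // (logn_unit l_k) [0 == i]eq_sym [RHS]addnC.
by rewrite [(_ + 1) * _]mulnDl mul1n.
Qed.

End RamifiedCase.
End Cases.

Theorem mainTheorem7 (p t n l : nat) (F : finFieldType) (V : vectType F)
    (p_prime : prime p) (t_gt0 : 0 < t) (cardF : #|F| = p ^ t)
    (n_ge4 : 4 <= n) (dimV : \dim (fullv : {vspace V}) = n)
    (l_prime : prime l) (l_neq_p : l <> p)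
    (d : 'rV[int]_#|line V|) (d_smith : smith_diagonal (skew_laplacian V) d) :
  let q := p ^ t in
  let f := qint q n - 1 in
  let g := qbinom F n 2 - qint q n in
  let r := (q ^ 2 * qint q (n - 3) * qint q n) %/ (q + 1) in
  let s :=
    (q * qint q (n - 1) * (qint q (n - 1) - (q + 2))) %/ (q + 1) in
  let mu :=
    (q ^ 3 * qint q (n - 3) * (qint q (n - 1) - (q + 2))) %/ (q + 1) in
  let K := critical_order V in
  let e := eldiv_mult d l in
  (* (A) *)
  (~~ (l %| q + 1) ->
    [/\ ~ (l %| r /\ l %| s),
        ~~ (l %| r) -> ~~ (l %| s) -> ~~ (l %| K),
        (* (i) *)
        (l %| r -> ~~ (l %| s) ->
          [/\ (l %| qint q n -> ~~ (l %| qint q (n - 3)) ->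
                let a := logn l (qint q n) in
                exactly e [:: (a, f - 1); (0, g + 1)]),
              (l %| qint q n -> l %| qint q (n - 3) ->
                let a := logn l (qint q n) in
                let b := logn l (qint q (n - 3)) in
                exactly e [:: (a + b, f - 1); (b, 1); (0, g)])
            & (~~ (l %| qint q n) -> l %| qint q (n - 3) ->
                let a := logn l (qint q (n - 3)) in
                exactly e [:: (a, f); (0, g)])])
      & (* (ii) *)
        (l %| s -> ~~ (l %| r) ->
          (~~ (l %| qint q (n - 1)) ->
            let a := logn l s in
            exactly e [:: (a, g); (0, f)]) /\
          (l %| qint q (n - 1) ->
            let a := logn l (qint q (n - 1)) in
            let b := logn l mu in
            [/\ logn l s = a + b,
                b = 0 -> exactly e [:: (a, g - 1); (0, f + 1)]
              & 0 < b ->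
                exactly e [:: (a + b, g - 1); (b, 1); (0, f)]]))]) /\
  (* (B) *)
  (l %| q + 1 -> ~~ odd n ->
    let a := logn l r in
    let b := logn l s in
    [/\ 0 < a <-> 0 < b,
        a = 0 -> b = 0 -> ~~ (l %| K)
      & 0 < a -> 0 < b ->
        exactly e [:: (a + b, f - 1); (b, g - f + 1); (0, f)]]) /\
  (* (C) *)
  (l %| q + 1 -> odd n -> l %| K ->
    let a := logn l r in
    let b := logn l s in
    [/\ (0 < a /\ b = 0) \/ (a = 0 /\ 0 < b),
        (~~ (l %| (n - 1) %/ 2) ->
          (0 < a -> b = 0 -> exactly e [:: (a, f); (0, g)]) /\
          (a = 0 -> 0 < b -> exactly e [:: (b, g); (0, f)]))
      & (l %| (n - 1) %/ 2 ->
          [/\ 0 < b, a = 0 & exactly e [:: (b, g - 1); (0, f + 1)]])]).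
Proof.
subst n; pose q := #|F|; rewrite -cardF -/q.
have q_gt1 : 1 < q := card_finNzRing_gt1 F.
have l_q : ~~ (l %| q).
  rewrite /q cardF; rewrite Euclid_dvdX // dvdn_prime2 // t_gt0 andbT; exact/eqP.
have := exists_skew_numbers n_ge4; rewrite -/q; cbv zeta; set n := \dim {:V}; set P := qint q n.
set a := qint q (n - 1).
set x := qint q (n - 3); set k := a - (q + 2).
cbv zeta; set r := _ %/ _; set s := _ %/ _; set mu := _ %/ _; set g := _ - P.
move=> num; set f := P - 1; set e := eldiv_mult d l; set K := critical_order V.
have [h P_h] : exists h, P = h.+2.
  exists (P - 2); rewrite -addn2 subnK // (skew_P num) ltnS muln_gt0 ltnW //.
  by rewrite (skew_a num) addn2.
have [E1 E2 E3 E4] := skew_eldiv_mult l_prime l_q n_ge4 d_smith num P_h.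
have crit := smith_critical_order l_prime d_smith.
split; last split.
- move=> l_D; split.
  + exact: (tame_not_both l_prime l_q num).
  + by move=> lr ls; apply: crit; apply: (unit_rs E1).
  + by move=> lr ls; apply: (tame_dvd_r l_prime l_q num P_h E1).
  by move=> ls lr; apply: (tame_dvd_s l_prime l_q num P_h E2 E3).
- move=> l_D n_even.
  have [rs eB] := ramified_even l_prime num P_h E4 l_D n_even.
  have [_ _ r_gt0 s_gt0 _] := skew_positive num P_h.
  split=> // r0 s0.
  by apply: crit; apply: (unit_rs E1); rewrite dvdn_logn_gt0 ?r0 ?s0.
move=> l_D n_odd l_K; apply: (ramified_odd l_prime l_q (leq_trans _ n_ge4) num P_h E1 E3) => //.
by move/crit; rewrite -/K l_K.
Qed.
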